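(* (a) (Type I model.) Let $\mu$ be a probability measure on $\mathcal{X}_0$ with $\mu^{\mathbb{Z}}(\mathcal{X}^* )=1$, and let $\nu$ be the distribution of $U_{-1}(x)$ where $x\sim\mu^{\mathbb{Z}}$. Then $\mathcal{T}\mu^{\mathbb{Z}}=\mu^{\mathbb{Z}}$ if and only if $F(\mu\times\nu)=\mu\times\nu$. (b) (Type II model.) Let $\mu,\tilde\mu$ be probability measures on $\mathcal{X}_0,\tilde{\mathcal{X}}_0$ with $(\mu\times\tilde\mu)^{\mathbb{Z}}(\mathcal{X}^* )=1$, and let $\nu,\tilde\nu$ be the distributions of $U_{-1}(x)$ and $U_0(x)$ respectively, where $x\sim(\mu\times\tilde\mu)^{\mathbb{Z}}$. Then $\mathcal{T}(\mu\times\tilde\mu)^{\mathbb{Z}}=(\mu\times\tilde\mu)^{\mathbb{Z}}$ if and only if $F_*(\mu\times\nu)=\tilde\mu\times\tilde\nu$.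
   Context: Type I model: $\mathcal{X}_0,\mathcal{U}_0$ are Polish spaces and $F:\mathcal{X}_0\times\mathcal{U}_0\to\mathcal{X}_0\times\mathcal{U}_0$ is an involution; set $F_n^t:=F$ for all $n,t\in\mathbb{Z}$, and configurations are elements $x=(x_n)_{n\in\mathbb{Z}}\in\mathcal{X}_0^{\mathbb{Z}}$. Type II model: $\mathcal{X}_0,\tilde{\mathcal{X}}_0,\mathcal{U}_0,\tilde{\mathcal{U}}_0$ are Polish spaces and $F_*:\mathcal{X}_0\times\mathcal{U}_0\to\tilde{\mathcal{X}}_0\times\tilde{\mathcal{U}}_0$ is a bijection; set $F_n^t:=F_*$ if $n+t$ is even and $F_n^t:=F_*^{-1}$ if $n+t$ is odd; lattice variables satisfy $x_n^t\in\mathcal{X}_0$, $u_n^t\in\tilde{\mathcal{U}}_0$ if $n+t$ is even and $x_n^t\in\tilde{\mathcal{X}}_0$, $u_n^t\in\mathcal{U}_0$ if $n+t$ is odd; configurations are $x=(x_n)_{n\in\mathbb{Z}}$ with $x_n\in\mathcal{X}_0$ for $n$ even and $x_n\in\tilde{\mathcal{X}}_0$ for $n$ odd, and $(\mu\times\tilde\mu)^{\mathbb{Z}}$ denotes the product law under which $x_n\sim\mu$ for even $n$ and $x_n\sim\tilde\mu$ for odd $n$, all independent. In either case, $\mathcal{X}^*$ is the set of configurations $x$ for which there is a unique family $(x_n^t,u_n^t)_{n,t\in\mathbb{Z}}$ with $F_n^t(x_n^t,u_{n-1}^t)=(x_n^{t+1},u_n^t)$ for all $n,t\in\mathbb{Z}$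 and $x_n^0=x_n$ for all $n$. For $x\in\mathcal{X}^*$, $U_n(x):=u_n^0$, and the one-step dynamics is $\mathcal{T}(x)_n:=x_n^1$ for a type I model and $\mathcal{T}(x)_n:=x_{n+1}^1$ for a type II model. $G(m):=m\circ G^{-1}$ denotes pushforward. *)

(* Defs.v *)
From HB Require Import structures.
From mathcomp Require Import all_boot all_order all_algebra.
From mathcomp Require Import all_classical all_reals all_analysis.
Set Implicit Arguments. Unset Strict Implicit. Unset Printing Implicit Defensive.
Import Order.TTheory GRing.Theory Num.Theory.
Local Open Scope classical_set_scope.
Local Open Scope ring_scope.

Definition is_metric (R : realType) (T : Type) (dist : T -> T -> R) : Prop :=
  (forall x y, dist x y = 0 <-> x = y) /\
  (forall x y, dist x y = dist y x) /\
  (forall x y z, dist x z <= dist x y + dist y z).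

Definition metric_open (R : realType) (T : Type) (dist : T -> T -> R)
  (U : set T) : Prop :=
  forall x, U x -> exists e : R, 0 < e /\ forall y, dist x y < e -> U y.

Definition metric_complete (R : realType) (T : Type) (dist : T -> T -> R) : Prop :=
  forall u : nat -> T,
    (forall e : R, 0 < e -> exists N : nat, forall m n : nat,
        (N <= m)%N -> (N <= n)%N -> dist (u m) (u n) < e) ->
    exists l : T, forall e : R, 0 < e -> exists N : nat, forall n : nat,
        (N <= n)%N -> dist (u n) l < e.

Definition metric_separable (R : realType) (T : Type) (dist : T -> T -> R) : Prop :=
  exists D : set T, countable D /\
    forall x (e : R), 0 < e -> exists y, D y /\ dist x y < e.

Definition polish (R : realType) (d : measure_display) (T : measurableType d) : Prop :=
  exists dist : T -> T -> R,
    is_metric dist /\ metric_complete dist /\ metric_separable dist /\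
    (@measurable d T = <<s metric_open dist >>).

(* Completion of a measure: S is P-measurable in the completion, with    *)
(* completed measure r.                                                  *)
Definition cmeasure_is (R : realType) (d : measure_display) (T : measurableType d)
  (P : set T -> \bar R) (S : set T) (r : \bar R) : Prop :=
  exists M1 M2 : set T, measurable M1 /\ measurable M2 /\
    M1 `<=` S /\ S `<=` M2 /\ P (M2 `\` M1) = 0%E /\ P M1 = r.

Definition cylI (d : measure_display) (X : measurableType d) : set (set (int -> X)) :=
  fun C => exists (n : int) (A : set X), measurable A /\ C = [set x | A (x n)].

Definition configI (d : measure_display) (X : measurableType d) :=
  g_sigma_algebraType (@cylI _ X).

Definition iid_lawI (R : realType) (d : measure_display) (X : measurableType d)
  (mu : set X -> \bar R) (P : set (configI X) -> \bar R) : Prop :=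
  forall (s : seq int) (A : int -> set X), uniq s -> (forall n, measurable (A n)) ->
    P [set x : configI X | forall n, n \in s -> A n (x n)] = (\prod_(n <- s) mu (A n))%E.

(* (xl n t, ul n t) = (x_n^t, u_n^t) solves the lattice equations with initial
   condition x *)
Definition solvesI (X U : Type) (F : X * U -> X * U) (x : int -> X)
  (xl : int -> int -> X) (ul : int -> int -> U) : Prop :=
  (forall n t : int, F (xl n t, ul (n - 1) t) = (xl n (t + 1), ul n t)) /\
  (forall n : int, xl n 0 = x n).

Definition XstarI (X U : Type) (F : X * U -> X * U) : set (int -> X) :=
  [set x | exists xl ul, solvesI F x xl ul /\
     forall xl' ul', solvesI F x xl' ul' -> xl' = xl /\ ul' = ul].

Definition U_preI (X U : Type) (F : X * U -> X * U) (n : int) (B : set U) : set (int -> X) :=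
  [set x | XstarI F x /\ exists xl ul, solvesI F x xl ul /\ B (ul n 0)].

Definition T_preI (X U : Type) (F : X * U -> X * U) (A : set (int -> X)) : set (int -> X) :=
  [set x | XstarI F x /\ exists xl ul, solvesI F x xl ul /\ A (fun n => xl n 1)].

(* T mu^Z = mu^Z (T defined on the full-measure set X^*; preimages are taken
   in the completion of P) *)
Definition T_invariantI (R : realType) (dX : measure_display) (X : measurableType dX)
  (U : Type) (F : X * U -> X * U) (P : set (configI X) -> \bar R) : Prop :=
  forall A : set (configI X), measurable A -> cmeasure_is P (T_preI F A) (P A).

(* A configuration x = (x_n) with x_n in X0 (n even), in Xt (n odd) is encoded
   as y : int -> X0 * Xt with x_{2k} = (y k).1 and x_{2k+1} = (y k).2. *)

Definition cylII (d d' : measure_display) (X : measurableType d)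
  (Xt : measurableType d') : set (set (int -> X * Xt)) :=
  fun C => (exists (k : int) (A : set X), measurable A /\ C = [set y | A (y k).1]) \/
           (exists (k : int) (B : set Xt), measurable B /\ C = [set y | B (y k).2]).

Definition configII (d d' : measure_display) (X : measurableType d)
  (Xt : measurableType d') := g_sigma_algebraType (@cylII _ _ X Xt).

Definition iid_lawII (R : realType) (d d' : measure_display) (X : measurableType d)
  (Xt : measurableType d') (mu : set X -> \bar R) (mut : set Xt -> \bar R)
  (P : set (configII X Xt) -> \bar R) : Prop :=
  forall (s : seq int) (A : int -> set X) (B : int -> set Xt), uniq s ->
    (forall k, measurable (A k)) -> (forall k, measurable (B k)) ->
    P [set y : configII X Xt | forall k, k \in s -> A k (y k).1 /\ B k (y k).2]
      = (\prod_(k <- s) (mu (A k) * mut (B k)))%E.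

(* Lattice variables: for n + t even, x_n^t = xe n t : X0 and u_n^t = ue n t : Ut;
   for n + t odd, x_n^t = xo n t : Xt and u_n^t = uo n t : U0.  (Values of
   xe, ue at odd n+t and of xo, uo at even n+t are irrelevant.)
   F_n^t = Fs for n + t even, Fs^{-1} for n + t odd; the equation
   Fs^{-1}(a) = b is written a = Fs b (Fs is a bijection). *)
Definition solvesII (X Xt U Ut : Type) (Fs : X * U -> Xt * Ut) (y : int -> X * Xt)
  (xe : int -> int -> X) (xo : int -> int -> Xt)
  (ue : int -> int -> Ut) (uo : int -> int -> U) : Prop :=
  (forall n t : int, (2 %| n + t)%Z ->
      Fs (xe n t, uo (n - 1) t) = (xo n (t + 1), ue n t)) /\
  (forall n t : int, ~~ (2 %| n + t)%Z ->
      (xo n t, ue (n - 1) t) = Fs (xe n (t + 1), uo n t)) /\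
  (forall k : int, xe (2 * k) 0 = (y k).1 /\ xo (2 * k + 1) 0 = (y k).2).

Definition same_latticeII (X Xt U Ut : Type)
  (xe : int -> int -> X) (xo : int -> int -> Xt) (ue : int -> int -> Ut) (uo : int -> int -> U)
  (xe' : int -> int -> X) (xo' : int -> int -> Xt) (ue' : int -> int -> Ut) (uo' : int -> int -> U)
  : Prop :=
  forall n t : int,
    ((2 %| n + t)%Z -> xe n t = xe' n t /\ ue n t = ue' n t) /\
    (~~ (2 %| n + t)%Z -> xo n t = xo' n t /\ uo n t = uo' n t).

Definition XstarII (X Xt U Ut : Type) (Fs : X * U -> Xt * Ut) : set (int -> X * Xt) :=
  [set y | exists xe xo ue uo, solvesII Fs y xe xo ue uo /\
     forall xe' xo' ue' uo', solvesII Fs y xe' xo' ue' uo' ->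
       same_latticeII xe xo ue uo xe' xo' ue' uo'].

Definition Um1_preII (X Xt U Ut : Type) (Fs : X * U -> Xt * Ut) (B : set U)
  : set (int -> X * Xt) :=
  [set y | XstarII Fs y /\ exists xe xo ue uo, solvesII Fs y xe xo ue uo /\ B (uo (-1) 0)].

Definition U0_preII (X Xt U Ut : Type) (Fs : X * U -> Xt * Ut) (B : set Ut)
  : set (int -> X * Xt) :=
  [set y | XstarII Fs y /\ exists xe xo ue uo, solvesII Fs y xe xo ue uo /\ B (ue 0 0)].

(* T(x)_n = x_{n+1}^1; in the pair encoding
   T(y)_k = (x_{2k+1}^1, x_{2k+2}^1) = (xe (2k+1) 1, xo (2k+2) 1). *)
Definition T_preII (X Xt U Ut : Type) (Fs : X * U -> Xt * Ut) (A : set (int -> X * Xt))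
  : set (int -> X * Xt) :=
  [set y | XstarII Fs y /\ exists xe xo ue uo, solvesII Fs y xe xo ue uo /\
     A (fun k => (xe (2 * k + 1) 1, xo (2 * k + 2) 1))].

Definition T_invariantII (R : realType) (d d' : measure_display) (X : measurableType d)
  (Xt : measurableType d') (U Ut : Type) (Fs : X * U -> Xt * Ut)
  (P : set (configII X Xt) -> \bar R) : Prop :=
  forall A : set (configII X Xt), measurable A -> cmeasure_is P (T_preII Fs A) (P A).

(* Main.v *)
(* Given the past, the carrier U_{-1} is a function of the sites x_n with n < 0:
   re-solving the upper half-lattice to the right of a site after changing the
   configuration there leaves everything to its left unchanged. Hence (x_0, U_{-1})
   has law mu x nu. If the product law is invariant, then the space-time reversed
   lattice started from the time-one configuration is again a typical lattice, its
   carrier retraces U, and so (x_0^1, U_0), the image of (x_0, U_{-1}), is a product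
   with the required marginals. Conversely, if F maps mu x nu to the product law, an
   induction along the sites shows that x_a^1, ..., x_b^1, U_b are independent.
   Measurability is only given in the completion of P: carriers are replaced by
   almost surely equal measurable functions, and for type II the inverse of F_* is
   made almost surely measurable by inner approximation with compact subsets of its
   graph. Type I reduces to type II by reading configurations in pairs. *)
Require Import Defs.
From HB Require Import structures.
From mathcomp Require Import all_boot all_order all_algebra.
From mathcomp Require Import all_classical all_reals all_analysis.
From mathcomp Require Import lra zify.
Import Order.TTheory GRing.Theory Num.Theory.
Local Open Scope classical_set_scope.
Local Open Scope ring_scope.
Set Implicit Arguments. Unset Strict Implicit. Unset Printing Implicit Defensive.

(** * Probability up to null sets *)

(** Reversal is natural in the direct implication because the pair leaving a site, (x_0^1, U_0),
    enters a site of the reversed lattice: there U_0 arrives from the left, so the one-sided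
    dependence that splits (x_0, U_{-1}) applies again. Invariance is used on the event that the
    reversed time-one configuration is typical and satisfies the event of interest. This bounds one
    probability by the other for every event, and passing to complements gives equality. In the
    converse the outgoing carrier belongs to the induction hypothesis because it is the only channel
    through which the treated sites act on the next one. The two kinds of sites alternate: [Fs]
    carries mu x nu to mut x nut at even sites and its inverse carries mut x nut back to mu x nu at
    odd sites. The almost surely measurable inverse is therefore taken relative to mut x nut, the
    law of the pair entering an odd site. *)

Lemma measurable_preimage d d' (T : measurableType d) (T' : measurableType d')
    (f : T -> T') (B : set T') :
  measurable_fun setT f -> measurable B -> measurable (f @^-1` B).
Proof. by move=> mf mB; rewrite -[X in measurable X]setTI; exact: mf. Qed.

Section full_measure.
Context (R : realType) d (T : measurableType d) (P : probability T R).
Local Open Scope ereal_scope.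

Definition full (K : set T) := measurable K /\ P K = 1.

Lemma fullC0 K : full K -> P (~` K) = 0.
Proof. by move=> [mK PK]; rewrite probability_setC// PK subee. Qed.

Lemma C0_full K : measurable K -> P (~` K) = 0 -> full K.
Proof.
move=> mK PK; split => //; rewrite -(setCK K) probability_setC ?PK ?sube0//.
exact: measurableC.
Qed.

Lemma fullT : full setT.
Proof. by split => //; exact: probability_setT. Qed.

Lemma full_bigcap (K : nat -> set T) :
  (forall n, full (K n)) -> full (\bigcap_n K n).
Proof.
move=> fK; apply: C0_full; first by apply: bigcapT_measurable => n; case: (fK n).
rewrite setC_bigcap; apply/negligibleP.
  by apply: bigcupT_measurable => n; apply: measurableC; case: (fK n).
apply: negligible_bigcup => n; apply/negligibleP.
  by apply: measurableC; case: (fK n).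
exact: fullC0.
Qed.

Lemma full_countable (I : countType) (K : I -> set T) :
  (forall i, full (K i)) -> full [set x | forall i, K i x].
Proof.
move=> fK; pose L n := if unpickle n is Some i then K i else setT.
have -> : [set x | forall i, K i x] = \bigcap_n L n.
  apply/seteqP; split => [x Kx n _|x Lx i].
    by rewrite /L; case: unpickle => // i; exact: Kx.
  by have := Lx (pickle i) Logic.I; rewrite /L pickleK; apply.
by apply: full_bigcap => n; rewrite /L; case: unpickle => [i|]; [exact: fK|exact: fullT].
Qed.

Lemma fullI K L : full K -> full L -> full (K `&` L).
Proof.
move=> fK fL; have := @full_countable bool (fun b => if b then K else L).
have -> : [set x | forall b : bool, (if b then K else L) x] = K `&` L.
  apply/seteqP; split => [x KL|x [Kx Lx] []//].
  by split; [exact: (KL true)|exact: (KL false)].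
by apply => -[].
Qed.

Lemma le_full K A B : full K -> measurable A -> measurable B ->
  (forall x, K x -> A x -> B x) -> P A <= P B.
Proof.
move=> fK mA mB AB; have [mK _] := fK.
have mC := measurableC mK.
apply: (@le_trans _ _ (P (B `|` ~` K))).
  apply: le_measure; rewrite ?inE//; first exact: measurableU.
  by move=> x Ax; have [Kx|nKx] := pselect (K x); [left; exact: AB|right].
by apply: le_trans (measureU2 _ _ _) _ => //; rewrite [X in _ + X]fullC0// adde0.
Qed.

Lemma eq_full K A B : full K -> measurable A -> measurable B ->
  (forall x, K x -> A x <-> B x) -> P A = P B.
Proof.
move=> fK mA mB AB; apply/eqP; rewrite eq_le.
by apply/andP; split; apply: (le_full fK) => // x /AB[].
Qed.

(** Off the null set between [M1] and [M2], [S] coincides with [M1]; so every measurable set almost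
    everywhere equal to [S] has its completed measure. *)
Lemma cmeasure_full S r K A : cmeasure_is P S r -> full K -> measurable A ->
  (forall x, K x -> S x <-> A x) -> P A = r.
Proof.
move=> [M1 [M2 [mM1 [mM2 [M1S [SM2 [M21 <-]]]]]]] fK mA SA.
have fM : full (~` (M2 `\` M1)).
  apply: C0_full; first by apply: measurableC; exact: measurableD.
  by rewrite setCK.
apply: (eq_full (fullI fK fM)) => // x [Kx M12x]; split.
  move/(SA _ Kx)/SM2 => M2x; apply: contrapT => nM1x; exact: M12x.
by move/M1S/(SA _ Kx).
Qed.

Lemma full_cmeasure S r K A : full K -> measurable A -> P A = r ->
  (forall x, K x -> S x <-> A x) -> cmeasure_is P S r.
Proof.
move=> fK mA <- SA; have [mK _] := fK.
exists (A `&` K), (A `|` ~` K); have mAK := measurableI _ _ mA mK.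
have mAC := measurableU _ _ mA (measurableC mK).
split => //; split => //.
split; first by move=> x [Ax Kx]; exact/SA.
split.
  by move=> x Sx; have [Kx|] := pselect (K x); [left; exact/SA|right].
split; last by apply: (eq_full fK) => // x Kx; split => [[]|].
apply: (subset_measure0 _ _ _ (fullC0 fK)).
- exact: measurableD.
- exact: measurableC.
- by move=> x [[Ax nAK|//] Kx]; exact: nAK.
Qed.

End full_measure.

Lemma full_preimage (R : realType) d d' (T : measurableType d)
    (T' : measurableType d') (P : probability T R) (Q : probability T' R)
    (f : T -> T') (K : set T') :
  measurable_fun setT f ->
  (forall A, measurable A -> P (f @^-1` A) = Q A) ->
  full Q K -> full P (f @^-1` K).
Proof.
by move=> mf fPQ [mK QK]; split; [exact: measurable_preimage|rewrite fPQ].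
Qed.

(* Taking E = setT yields uniqueness of laws; a smaller E yields conditional
   laws, and hence independence statements. *)
Lemma law_unique (R : realType) d d' (T : measurableType d)
    (T' : measurableType d') (P : probability T R) (Q : probability T' R)
    (G : set (set T')) (f : T -> T') (E : set T) :
  measurable = <<s G >> -> setI_closed G -> measurable_fun setT f ->
  measurable E ->
  (forall A, G A -> P (E `&` f @^-1` A) = P E * Q A)%E ->
  forall A, measurable A -> P (E `&` f @^-1` A) = (P E * Q A)%E.
Proof.
move=> mG GI mf mE PQ A; rewrite [X in X A]mG.
have fin (X : set T) : measurable X -> P X \is a fin_num by move=> ?; rewrite fin_num_measure.
have mEf (X : set T') : measurable X -> measurable (E `&` f @^-1` X).
  by move=> mX; apply: measurableI => //; exact: measurable_preimage.
apply: (dynkin_induction (P := fun A => P (E `&` f @^-1` A) = (P E * Q A)%E) mG) => //.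
- by rewrite preimage_setT setIT probability_setT mule1.
- move=> S mS PS; transitivity (P E - P (E `&` f @^-1` S))%E.
    rewrite -measureD//; first exact: measurable_preimage.
    by rewrite ltey_eq fin.
  rewrite PS probability_setC// muleBr ?mule1 ?fin//.
- move=> F mF tF PF; rewrite preimage_bigcup setI_bigcupr.
  rewrite measure_bigcup//; last 2 first.
  + by move=> i _; exact: mEf.
  + move=> i j _ _ [x [[_ Fi] [_ Fj]]]; apply: (tF i j) => //; by exists (f x).
  rewrite (measure_bigcup Q)// -(fineK (fin _ mE)) -nneseriesZl//.
  by apply: eq_eseriesr => i _; rewrite fineK ?fin //; exact: PF.
Qed.

Lemma law_unique_prod (R : realType) d d1 d2 (T : measurableType d)
    (T1 : measurableType d1) (T2 : measurableType d2) (P : probability T R)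
    (Q1 : probability T1 R) (Q2 : probability T2 R)
    (f1 : T -> T1) (f2 : T -> T2) (E : set T) :
  measurable_fun setT f1 -> measurable_fun setT f2 -> measurable E ->
  (forall A B, measurable A -> measurable B ->
     P (E `&` (f1 @^-1` A `&` f2 @^-1` B)) = P E * (Q1 A * Q2 B))%E ->
  forall C, measurable C ->
    P (E `&` (fun x => (f1 x, f2 x)) @^-1` C) = (P E * (Q1 \x Q2)%E C)%E.
Proof.
move=> mf1 mf2 mE PQ C mC.
apply: (law_unique (Q := (Q1 \x Q2)%E) (measurable_prod_measurableType T1 T2)) => //.
- move=> _ _ [A1 mA1 [B1 mB1 <-]] [A2 mA2 [B2 mB2 <-]].
  exists (A1 `&` A2); first exact: measurableI.
  by exists (B1 `&` B2); [exact: measurableI|rewrite setXI].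
- exact: measurable_fun_pair.
- move=> _ [A mA [B mB <-]].
  by rewrite [X in (_ * X)%E](product_measure1E Q1 Q2 mA mB); exact: PQ.
Qed.

(* Resampling one coordinate: s w z replaces the coordinate p w by z. An event
   that is almost surely unaffected by this is independent of the coordinate. *)
Lemma resampling_indep (R : realType) d d' (T : measurableType d)
    (X : measurableType d') (P : probability T R) (mu : probability X R)
    (p : T -> X) (s : T * X -> T) (K S : set T) :
  measurable_fun setT s -> measurable_fun setT p ->
  (forall w, p (s w) = w.2) ->
  (forall A, measurable A -> (P \x mu)%E (s @^-1` A) = P A) ->
  full P K -> measurable S ->
  (forall w, K w.1 -> K (s w) -> S (s w) <-> S w.1) ->
  forall A, measurable A -> P (S `&` p @^-1` A) = (P S * mu A)%E.
Proof.
move=> ms mp psE sP fK mS KS A mA.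
have mSA : measurable (S `&` p @^-1` A).
  by apply: measurableI => //; exact: measurable_preimage.
rewrite -sP// -product_measure1E//.
have f1 : full (P \x mu)%E (K `*` setT).
  have [mK PK] := fK; split; first exact: measurableX.
  transitivity (P K * mu setT)%E; first exact: product_measure1E.
  by rewrite PK probability_setT mule1.
have f2 := @full_preimage _ _ _ _ _ (P \x mu)%E P s K ms sP fK.
apply: (eq_full (fullI f1 f2)).
- exact: measurable_preimage.
- exact: measurableX.
- move=> w [[K1 _] K2] /=; rewrite -/(p (s w)) psE.
  by split => -[/(KS _ K1 K2)].
Qed.

(** * Polish spaces *)

Lemma natSinv_lt (R : realType) (e : R) : 0 < e -> exists n : nat, n.+1%:R^-1 < e.
Proof.
move=> e0; have [N _ H] := near_infty_natSinv_lt (PosNum e0).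
by exists N; exact: (H N (leqnn N)).
Qed.

Lemma natSinv_gt0 (R : realType) (n : nat) : 0 < (n.+1%:R : R)^-1.
Proof. by rewrite invr_gt0. Qed.

Lemma measure_bigcap_lt (R : realType) d (T : measurableType d)
    (P : probability T R) (F : nat -> set T) (e : \bar R) :
  (forall n, measurable (F n)) -> (forall m n, (m <= n)%N -> F n `<=` F m) ->
  (P (\bigcap_n F n) < e)%E -> exists n, (P (F n) < e)%E.
Proof.
move=> mF dF Fe; apply: contrapT => H.
have cv : (P \o F) x @[x --> \oo] --> P (\bigcap_n F n).
  apply: nonincreasing_cvg_mu => //.
  - by rewrite ltey_eq fin_num_measure.
  - exact: bigcapT_measurable.
  - by move=> m n mn; apply/subsetPset; exact: dF.
suff : (e <= P (\bigcap_n F n))%E by rewrite leNgt Fe.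
rewrite -(cvg_lim _ cv)//; apply: lime_ge; first by apply/cvg_ex; eexists; exact: cv.
by apply: nearW => n /=; rewrite leNgt; apply/negP => h; apply: H; exists n.
Qed.

Definition polish_metric (R : realType) d (T : measurableType d)
    (dist : T -> T -> R) :=
  is_metric dist /\ metric_complete dist /\ metric_separable dist /\
  @measurable d T = <<s metric_open dist >>.

Definition mball (R : realType) (T : Type) (dist : T -> T -> R) x e :=
  [set y | dist x y < e].

Section metric.
Context (R : realType) (T : Type) (dist : T -> T -> R).
Hypothesis hd : is_metric dist.

Lemma metric_dist0 x : dist x x = 0. Proof. by case: hd => h _; apply/h. Qed.
Lemma metric_distC x y : dist x y = dist y x. Proof. by case: hd => _ [h _]. Qed.
Lemma metric_dist_triangle y x z : dist x z <= dist x y + dist y z.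
Proof. by case: hd => _ [_ h]. Qed.
Lemma metric_dist_ge0 x y : 0 <= dist x y.
Proof. by have := metric_dist_triangle y x x; rewrite metric_dist0 (metric_distC y x); lra. Qed.

Lemma metric_dist_gt0 x y : x <> y -> 0 < dist x y.
Proof.
move=> xy; rewrite lt_neqAle metric_dist_ge0 andbT; apply/eqP => h; apply: xy.
by case: hd => h' _; apply/h'.
Qed.

Lemma mball_open x e : metric_open dist (mball dist x e).
Proof.
move=> y; rewrite /mball/= => xy; exists (e - dist x y); split; first by rewrite subr_gt0.
by move=> z yz; have := metric_dist_triangle y x z; lra.
Qed.

Lemma metric_openT : metric_open dist setT.
Proof. by move=> x _; exists 1; split. Qed.

Lemma metric_openI A B :
  metric_open dist A -> metric_open dist B -> metric_open dist (A `&` B).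
Proof.
move=> oA oB x [/oA[e1 [e10 h1]] /oB[e2 [e20 h2]]].
exists (Num.min e1 e2); split; first by rewrite lt_min e10.
by move=> y; rewrite lt_min => /andP[/h1 ? /h2 ?].
Qed.

Lemma metric_open_bigcup (I : Type) (D : set I) (A : I -> set T) :
  (forall i, metric_open dist (A i)) -> metric_open dist (\bigcup_(i in D) A i).
Proof.
move=> oA x [i Di /oA[e [e0 h]]]; exists e; split => // y /h ?; by exists i.
Qed.

Definition metric_closed (F : set T) := metric_open dist (~` F).

Lemma metric_closed_bigcap (I : Type) (D : set I) (A : I -> set T) :
  (forall i, metric_closed (A i)) -> metric_closed (\bigcap_(i in D) A i).
Proof.
by move=> cA; rewrite /metric_closed setC_bigcap; apply: metric_open_bigcup => i; exact: cA.
Qed.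

Lemma metric_closed_bigcup_ord (A : nat -> set T) n :
  (forall i, metric_closed (A i)) -> metric_closed (\bigcup_(i < n) A i).
Proof.
move=> cA; rewrite bigcup_mkord; elim: n => [|n IH].
  by rewrite big_ord0 /metric_closed setC0; exact: metric_openT.
by rewrite big_ord_recr/= /metric_closed setCU; apply: metric_openI; [exact: IH|exact: cA].
Qed.

Lemma metric_closed_lim (F : set T) (u : nat -> T) l :
  metric_closed F -> (forall n, F (u n)) ->
  (forall e, 0 < e -> exists N, forall n, (N <= n)%N -> dist (u n) l < e) -> F l.
Proof.
move=> cF uF ul; apply: contrapT => /cF[e [e0 h]].
have [N /(_ N (leqnn N))] := ul e e0.
by rewrite metric_distC => /h; apply; exact: uF.
Qed.

Lemma metric_second_countable : metric_separable dist ->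
  exists V : nat -> set T,
    (forall n, V n = set0 \/ exists y e, V n = mball dist y e) /\
    forall U, metric_open dist U -> forall x, U x ->
      exists n, V n x /\ V n `<=` U.
Proof.
move=> [D [/countable_injP[f finj] dD]].
(* The ball of radius 1/(j+1) about the point of [D] with code [k], written as a union so that it is
   empty when no point has this code. *)
pose W k j := \bigcup_(y in [set y | D y /\ f y = k]) mball dist y j.+1%:R^-1.
have WE y j : D y -> W (f y) j = mball dist y j.+1%:R^-1.
  move=> Dy; apply/seteqP; split => [x [z [Dz fzy]]|x yx]; last by exists y.
  by rewrite (finj z y) ?inE.
exists (fun n => if unpickle n is Some kj then W kj.1 kj.2 else set0); split.
  move=> n; case: unpickle => [[k j]/=|]; last by left.
  have [[y [Dy <-]]|nk] := pselect (exists y, D y /\ f y = k).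
    by right; exists y, j.+1%:R^-1; rewrite WE.
  by left; apply/seteqP; split => [x [y Dy _]|//]; apply: nk; exists y.
move=> U oU x Ux; have [e [e0 he]] := oU x Ux.
have [j je] : exists n : nat, n.+1%:R^-1 < e / 2 by apply: natSinv_lt; rewrite divr_gt0.
have [y [Dy yx]] := dD x _ (natSinv_gt0 R j).
exists (pickle (f y, j)); rewrite pickleK/= WE//; split.
  by rewrite /mball/= metric_distC.
move=> z; rewrite /mball/= => yz; apply: he.
by have := metric_dist_triangle y x z; move: je yx yz; move: (_^-1) => r; lra.
Qed.

End metric.

Lemma polish_open_measurable (R : realType) d (T : measurableType d)
    (dist : T -> T -> R) U :
  polish_metric dist -> metric_open dist U -> measurable U.
Proof. by move=> [_ [_ [_ ->]]] oU; exact: sub_sigma_algebra. Qed.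

Lemma polish_closed_measurable (R : realType) d (T : measurableType d)
    (dist : T -> T -> R) F :
  polish_metric dist -> metric_closed dist F -> measurable F.
Proof.
by move=> pd cF; rewrite -(setCK F); apply: measurableC; exact: (polish_open_measurable pd).
Qed.

(* A function into a Polish space whose fibres of measurable sets are measurable
   in the completion agrees almost surely with a measurable function: only
   countably many fibres have to be repaired. *)
Lemma ae_measurable (R : realType) d d' (T : measurableType d)
    (T' : measurableType d') (P : probability T R) (f : T -> T') (K : set T) :
  polish R T' -> full P K ->
  (forall B, measurable B ->
     exists S r, cmeasure_is P S r /\ forall x, K x -> S x <-> B (f x)) ->
  exists (g : T -> T') (L : set T), measurable_fun setT g /\ full P L /\
    L `<=` K /\ forall x, L x -> g x = f x.
Proof.
move=> [dist pd] fK fB; have [hd [_ [sd mE]]] := pd.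
have [V [Vball Vbase]] := metric_second_countable hd sd.
have mV n : measurable (V n).
  by case: (Vball n) => [->//|[y [e ->]]]; apply: (polish_open_measurable pd); exact: mball_open.
have /choice[M hM] : forall n, exists M : set T * set T,
    [/\ measurable M.1, full P (~` (M.2 `\` M.1)) &
     forall x, K x -> ~ (M.2 `\` M.1) x -> M.1 x <-> V n (f x)].
  move=> n; have [S [r [[M1 [M2 [mM1 [mM2 [M1S [SM2 [M21 _]]]]]]] SB]]] := fB _ (mV n).
  exists (M1, M2); split => //=.
    apply: C0_full; first by apply: measurableC; exact: measurableD.
    by rewrite setCK.
  move=> x Kx nM; split; first by move/M1S/SB; exact.
  by move/(SB _ Kx)/SM2 => M2x; apply: contrapT => nM1x; exact: nM.
(* On [L] the fibre of each base set [V n] is exactly the measurable set [(M n).1]. *)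
pose L := K `&` \bigcap_n (~` ((M n).2 `\` (M n).1)).
have fL : full P L by apply: fullI => //; apply: full_bigcap => n; case: (hM n).
have [x0 Lx0] : L !=set0.
  apply/set0P/eqP => L0; have [_] := fL; rewrite L0 measure0 => /esym/eqP.
  by rewrite onee_eq0.
have [mL _] := fL.
(* Off [L] the function is made constant, with a value [f x0] taken from [L]; preimages of open sets
   then split along [L] into a countable union and a trivial part. *)
exists (fun x => if pselect (L x) then f x else f x0), L; split; last first.
  by split => //; split => [x []//|x Lx]; case: pselect.
apply: (measurability (metric_open dist)) => // _ [U oU <-]; rewrite setTI.
have -> : (fun x => if pselect (L x) then f x else f x0) @^-1` U =
    (L `&` \bigcup_(n in [set n | V n `<=` U]) (M n).1) `|`
    (~` L `&` [set x | U (f x0)]).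
  have MV n x : L x -> (M n).1 x <-> V n (f x).
    by move=> [Kx nM]; have [_ _ h] := hM n; apply: h => //; exact: nM.
  apply/seteqP; split => x /=; case: pselect => // Lx Ux.
  - by left; split => //; have [n [Vn VU]] := Vbase _ oU _ Ux; exists n => //; apply/MV.
  - by right.
  - by case: Ux => [[_ [n VU /(MV _ _ Lx)/VU]]//|[]].
  - by case: Ux => [[]|[]].
apply: measurableU; apply: measurableI => //.
- by apply: bigcup_measurable => n _; case: (hM n).
- exact: measurableC.
- have [Ux|nUx] := pselect (U (f x0)).
    by have -> : [set _ : T | U (f x0)] = setT by apply/seteqP; split.
  by have -> : [set _ : T | U (f x0)] = set0 by apply/seteqP; split.
Qed.

Definition maxdist (R : realType) (X Y : Type) (d1 : X -> X -> R) (d2 : Y -> Y -> R)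
  (p q : X * Y) : R := Num.max (d1 p.1 q.1) (d2 p.2 q.2).

(** For the maximum metric, balls are rectangles. By separability every open set is a countable
    union of balls, so the Borel sets of the product metric are the product sigma-algebra. *)
Lemma polish_metric_prod (R : realType) d d' (X : measurableType d)
    (Y : measurableType d') (d1 : X -> X -> R) (d2 : Y -> Y -> R) :
  polish_metric d1 -> polish_metric d2 -> @polish_metric R _ (X * Y)%type (maxdist d1 d2).
Proof.
move=> pd1 pd2; have [h1 [c1 [s1 m1]]] := pd1; have [h2 [c2 [s2 m2]]] := pd2.
have hm : is_metric (maxdist d1 d2).
  split=> [[x y] [x' y']|]; rewrite /maxdist/=.
    split => [/eqP|[-> ->]]; last by rewrite (metric_dist0 h1) (metric_dist0 h2) maxxx.
    rewrite eq_le ge_max => /andP[/andP[le1 le2] _]; congr (_, _).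
      by have [h _] := h1; apply/h/eqP; rewrite eq_le le1 (metric_dist_ge0 h1).
    by have [h _] := h2; apply/h/eqP; rewrite eq_le le2 (metric_dist_ge0 h2).
  split=> [[x y] [x' y']|[x y] [x' y'] [x'' y'']]; rewrite /=.
    by rewrite (metric_distC h1) (metric_distC h2).
  rewrite ge_max; apply/andP; split.
    by apply: le_trans (metric_dist_triangle h1 x' _ _) _; apply: lerD; rewrite le_max lexx.
  by apply: le_trans (metric_dist_triangle h2 y' _ _) _; apply: lerD; rewrite le_max lexx orbT.
have sm : metric_separable (maxdist d1 d2).
  case: s1 s2 => [D1 [cD1 dD1]] [D2 [cD2 dD2]]; exists (D1 `*` D2); split.
    exact: countableX.
  move=> [x y] e e0; have [x' [Dx xx']] := dD1 x e e0; have [y' [Dy yy']] := dD2 y e e0.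
  by exists (x', y'); split => //; rewrite /maxdist gt_max /= xx'.
have cm : metric_complete (maxdist d1 d2).
  move=> u cu.
  have [x hx] : exists x, forall e, 0 < e -> exists N, forall n, (N <= n)%N -> d1 (u n).1 x < e.
    apply: c1 => e /cu[N hN]; exists N => m n Nm Nn.
    by have := hN m n Nm Nn; rewrite gt_max => /andP[].
  have [y hy] : exists y, forall e, 0 < e -> exists N, forall n, (N <= n)%N -> d2 (u n).2 y < e.
    apply: c2 => e /cu[N hN]; exists N => m n Nm Nn.
    by have := hN m n Nm Nn; rewrite gt_max => /andP[].
  exists (x, y) => e e0; have [N1 hN1] := hx e e0; have [N2 hN2] := hy e e0.
  exists (maxn N1 N2) => n; rewrite geq_max => /andP[/hN1 n1 /hN2 n2].
  by rewrite gt_max n1.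
split => //; split => //; split => //.
apply/seteqP; split.
  pose W := g_sigma_algebraType (metric_open (maxdist d1 d2)).
  have mf : measurable_fun (setT : set W) (fst : W -> X).
    apply: (measurability (metric_open d1)) => // _ [U oU <-]; rewrite setTI.
    apply: sub_sigma_algebra => -[x y] /= /oU[e [e0 he]]; exists e; split => //.
    by move=> [x' y']; rewrite gt_max => /andP[/he].
  have ms : measurable_fun (setT : set W) (snd : W -> Y).
    apply: (measurability (metric_open d2)) => // _ [U oU <-]; rewrite setTI.
    apply: sub_sigma_algebra => -[x y] /= /oU[e [e0 he]]; exists e; split => //.
    by move=> [x' y']; rewrite gt_max => /andP[_ /he].
  rewrite measurable_prod_measurableType; apply: smallest_sub.
    exact: (sigma_algebra_measurable W).
  move=> _ [A mA [B mB <-]].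
  have -> : A `*` B = (fst : W -> X) @^-1` A `&` (snd : W -> Y) @^-1` B by [].
  by apply: (@measurableI _ W); exact: measurable_preimage.
apply: smallest_sub; first exact: sigma_algebra_measurable.
move=> U oU.
have [V [Vball Vbase]] := metric_second_countable hm sm.
have -> : U = \bigcup_(n in [set n | V n `<=` U]) V n.
  apply/seteqP; split => [x Ux|x [n VU /VU]//].
  by have [n [Vx VU]] := Vbase _ oU _ Ux; exists n.
apply: bigcup_measurable => n _; case: (Vball n) => [->|[[x y] [e ->]]]; first exact: measurable0.
have -> : mball (maxdist d1 d2) (x, y) e = mball d1 x e `*` mball d2 y e.
  by apply/seteqP; split => -[x' y']; rewrite /mball /maxdist /= gt_max => /andP.
by apply: measurableX; [apply: (polish_open_measurable pd1)|apply: (polish_open_measurable pd2)];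
  exact: mball_open.
Qed.

(** * Regularity and tightness *)

(** Summing the bounds gives at most e/2; halving [e] beforehand makes the final inequality
    strict. *)
Lemma measure_bigcup_small (R : realType) d (T : measurableType d)
    (P : probability T R) (A : nat -> set T) (e : R) :
  (forall n, measurable (A n)) -> 0 < e ->
  (forall n, P (A n) < (e / 2 / (2 ^ n.+1)%:R)%:E)%E ->
  (P (\bigcup_n A n) < e%:E)%E.
Proof.
move=> mA e0 Ae; apply: (@le_lt_trans _ _ (e / 2)%:E); last by rewrite lte_fin; lra.
apply: le_trans (epsilon_trick0 xpredT _); last by rewrite divr_ge0// ltW.
apply: (@le_trans _ _ (\sum_(0 <= n <oo) P (A n))%E).
  by apply: measure_sigma_subadditive => //; exact: bigcupT_measurable.
by apply: lee_nneseries => // n _; exact: ltW.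
Qed.

(** For closed sets in a complete space this amounts to compactness. Covering by small sets instead
    of balls passes at once to subsets; 2/(j+1) bounds the diameter of a closed ball of radius
    1/(j+1). *)
Definition totally_bdd (R : realType) (T : Type) (dist : T -> T -> R)
    (K : set T) := forall j : nat, exists n (B : nat -> set T),
  K `<=` \bigcup_(k < n) B k /\
  forall k x y, B k x -> B k y -> dist x y <= 2 / j.+1%:R.

Section polish_probability.
Context (R : realType) d (T : measurableType d) (dist : T -> T -> R).
Hypothesis pd : polish_metric dist.
Variable P : probability T R.

Let hd : is_metric dist. Proof. by case: pd. Qed.
Let mo U : metric_open dist U -> measurable U.
Proof. exact: polish_open_measurable. Qed.
Let mc F : metric_closed dist F -> measurable F.
Proof. exact: polish_closed_measurable. Qed.

Definition regular (C : set T) := forall e : R, 0 < e ->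
  exists F G, [/\ metric_closed dist F, metric_open dist G, F `<=` C, C `<=` G &
    (P (G `\` F) < e%:E)%E].

(** The points at distance at least 1/(n+1) from the complement of [U] form closed sets [F n]
    increasing to [U]; continuity from above makes one of them large enough. *)
Lemma regular_open U : metric_open dist U -> regular U.
Proof.
move=> oU e e0.
pose F (n : nat) := [set x | forall y, dist x y < n.+1%:R^-1 -> U y].
have cF n : metric_closed dist (F n).
  move=> x /existsNP[y /not_implyP[xy nUy]].
  exists (n.+1%:R^-1 - dist x y); split; first by rewrite subr_gt0.
  move=> z xz Fz; apply/nUy/Fz.
  have := metric_dist_triangle hd x z y; rewrite (metric_distC hd z x).
  by move: xz; move: (_^-1) => r; lra.
have FU n : F n `<=` U.
  by move=> x; apply; rewrite (metric_dist0 hd); exact: natSinv_gt0.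
have [n Pn] : exists n, (P (U `\` F n) < e%:E)%E.
  apply: measure_bigcap_lt.
  - by move=> n; apply: measurableD; [exact: mo|exact: mc].
  - move=> m n mn x [Ux nFx]; split => // Fx; apply: nFx => y xy; apply: Fx.
    by apply: lt_le_trans xy _; rewrite lef_pV2 ?posrE// ler_nat.
  - rewrite (_ : \bigcap_n _ = set0) ?measure0 ?lte_fin//; apply/seteqP; split => // x UF.
    have [Ux _] := UF 0%N Logic.I; have [r [r0 hr]] := oU _ Ux.
    have [n nr] := natSinv_lt r0; have [_] := UF n Logic.I; apply => y xy.
    by apply: hr; exact: lt_trans nr.
by exists (F n), U; split.
Qed.

(** Regular sets form a sigma-algebra containing the open sets: complementation exchanges the inner
    closed set and the outer open set. *)
Lemma regular_measurable C : measurable C -> regular C.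
Proof.
case: pd => _ [_ [_ ->]]; move: C; apply: smallest_sub; last exact: regular_open.
split.
- move=> e e0; exists set0, set0; split => //; last by rewrite setD0 measure0.
  by rewrite /metric_closed setC0; exact: metric_openT.
- move=> C rC e /rC[F [G [cF oG FC CG PGF]]]; rewrite setTD.
  exists (~` G), (~` F); split => //; first by rewrite /metric_closed setCK.
  + exact: subsetC.
  + exact: subsetC.
  + by rewrite setDE setCK setIC -setDE.
move=> C rC e e0.
have /choice[FG hFG] : forall n, exists FG : set T * set T,
    [/\ metric_closed dist FG.1, metric_open dist FG.2, FG.1 `<=` C n, C n `<=` FG.2 &
    (P (FG.2 `\` FG.1) < (e / 2 / (2 ^ n.+1)%:R)%:E)%E].
  move=> n; have [|F [G H]] := rC n (e / 2 / (2 ^ n.+1)%:R); last by exists (F, G).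
  by rewrite !divr_gt0// ltr0n expn_gt0.
have cF n : metric_closed dist (FG n).1 by case: (hFG n).
have oG n : metric_open dist (FG n).2 by case: (hFG n).
have mG : measurable (\bigcup_n (FG n).2) by apply: bigcupT_measurable => n; exact: mo.
(* A countable union of closed sets need not be closed, so the inner union is cut at a finite [N],
   at a small cost by continuity from above. *)
have [N PN] : exists N, (P (\bigcup_n (FG n).2 `\` \bigcup_(n < N) (FG n).1) < e%:E)%E.
  apply: measure_bigcap_lt.
  - by move=> n; apply: measurableD => //; apply: mc; exact: metric_closed_bigcup_ord.
  - move=> m n mn x [Gx nF]; split => // -[k km Fk]; apply: nF; exists k => //.
    exact: leq_trans mn.
  - apply: le_lt_trans (@measure_bigcup_small _ _ _ P (fun n => (FG n).2 `\` (FG n).1) e _ e0 _).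
    + apply: le_measure; rewrite ?inE.
      * apply: bigcapT_measurable => n; apply: measurableD => //; apply: mc.
        exact: metric_closed_bigcup_ord.
      * by apply: bigcupT_measurable => n; apply: measurableD; [exact: mo|exact: mc].
      * move=> x H; have [[n _ Gx] _] := H 0%N Logic.I; exists n => //; split => // Fx.
        by have [_] := H n.+1 Logic.I; apply; exists n => /=.
    + by move=> n; apply: measurableD; [exact: mo|exact: mc].
    + by move=> n; case: (hFG n).
exists (\bigcup_(n < N) (FG n).1), (\bigcup_n (FG n).2); split => //.
- exact: metric_closed_bigcup_ord.
- exact: metric_open_bigcup.
- by move=> x [n nN Fx]; exists n => //; case: (hFG n) => _ _ + _ _; apply.
- by move=> x [n _ Cx]; exists n => //; case: (hFG n) => _ _ _ + _; apply.
Qed.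

(** Ulam's argument: at each scale 1/(j+1), finitely many closed balls about dense points carry all
    but e/2^(j+2) of the mass; the set is the intersection over all scales. *)
Lemma tight (e : R) : 0 < e ->
  exists K, [/\ metric_closed dist K, totally_bdd dist K & (P (~` K) < e%:E)%E].
Proof.
move=> e0; have [_ [_ [[D [/countable_injP[f finj] dD]] _]]] := pd.
pose B j k := [set x | exists y, [/\ D y, f y = k & dist y x <= j.+1%:R^-1]].
have cB j k : metric_closed dist (B j k).
  have [[y [Dy yk]]|nk] := pselect (exists y, D y /\ f y = k); last first.
    by move=> x _; exists 1; split => // z _ [y [Dy yk _]]; apply: nk; exists y.
  move=> x nBx; have yx : j.+1%:R^-1 < dist y x.
    by rewrite ltNge; apply/negP => yx; apply: nBx; exists y.
  exists (dist y x - j.+1%:R^-1); split; first by rewrite subr_gt0.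
  move=> z xz [y' [Dy' y'k y'z]].
  have y'y : y' = y by apply: finj; rewrite ?inE// y'k.
  have := metric_dist_triangle hd z y x; rewrite (metric_distC hd z x) -y'y.
  by move: xz y'z; rewrite -y'y; move: (_^-1) => r; lra.
have BT j x : exists k, B j k x.
  have [y [Dy xy]] := dD x _ (natSinv_gt0 R j).
  by exists (f y), y; split => //; rewrite (metric_distC hd); exact: ltW.
have cBn j n : metric_closed dist (\bigcup_(k < n) B j k) by exact: metric_closed_bigcup_ord.
have /choice[N hN] : forall j, exists n,
    (P (~` (\bigcup_(k < n) B j k)) < (e / 2 / (2 ^ j.+1)%:R)%:E)%E.
  move=> j; apply: measure_bigcap_lt.
  - by move=> n; apply: mo; exact: cBn.
  - by move=> m n mn x nB [k km Bk]; apply: nB; exists k => //; exact: leq_trans mn.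
  - rewrite (_ : \bigcap_n _ = set0) ?measure0 ?lte_fin.
      by rewrite !divr_gt0// ltr0n expn_gt0.
    apply/seteqP; split => // x H; have [k Bk] := BT j x.
    by apply: (H k.+1) => //; exists k => /=.
exists (\bigcap_j \bigcup_(k < N j) B j k); split.
- exact: metric_closed_bigcap.
- move=> j; exists (N j), (B j); split; first by move=> x; apply.
  move=> k x y [z [Dz zk zx]] [z' [Dz' z'k z'y]].
  have zz : z' = z by apply: finj; rewrite ?inE// z'k.
  have := metric_dist_triangle hd z x y; rewrite (metric_distC hd x z).
  by move: zx z'y; rewrite zz; move: (_^-1) => r; lra.
- rewrite setC_bigcap; apply: measure_bigcup_small => // j.
  by apply: mo; exact: cBn.
Qed.

Lemma inner_compact C (e : R) : measurable C -> 0 < e ->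
  exists K, [/\ metric_closed dist K, totally_bdd dist K, K `<=` C &
    (P (C `\` K) < e%:E)%E].
Proof.
move=> mC e0; have e20 : 0 < e / 2 by rewrite divr_gt0.
have [F [G [cF oG FC CG PGF]]] := regular_measurable mC e20.
have [K [cK tK PK]] := tight e20.
exists (F `&` K); split.
- rewrite /metric_closed setCI => x [/cF|/cK] [r [r0 h]]; exists r; split => // y /h;
    by [left|right].
- by move=> j; have [n [B [KB dB]]] := tK j; exists n, B; split => // x [_ /KB].
- by move=> x [/FC].
have mK := mc cK; have mF := mc cF; have mG := mo oG.
have mGF := measurableD mG mF; have mKC := measurableC mK.
apply: (@le_lt_trans _ _ (P ((G `\` F) `|` ~` K))).
  apply: le_measure; rewrite ?inE.
  - by apply: measurableD => //; exact: measurableI.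
  - exact: measurableU.
  - move=> x [/CG Gx nFK]; have [Kx|] := pselect (K x); last by right.
    by left; split => // Fx; exact: nFK.
apply: le_lt_trans (measureU2 _ mGF mKC) _.
by rewrite [X in (_ < X%:E)%E](splitr e) EFinD; exact: lteD.
Qed.

End polish_probability.

(** * Almost sure inverses *)

Section closed_image.
Context (R : realType) (W Y : Type) (dW : W -> W -> R) (dY : Y -> Y -> R) (q : W -> Y).
Hypotheses (hW : is_metric dW) (cW : metric_complete dW) (hY : is_metric dY).
Hypothesis q_lip : forall w w', dY (q w) (q w') <= dW w w'.

Let adherent y (L : set W) := forall e : R, 0 < e -> exists w, L w /\ dY y (q w) < e.

(** Pigeonhole: if [y] is not adherent to the image of the last piece, a ball about [y] avoids that
    piece, which can then be discarded. *)
Let adherent_split y n (B : nat -> set W) L : adherent y L ->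
  L `<=` \bigcup_(k < n) B k -> exists k, adherent y (L `&` B k).
Proof.
elim: n L => [|n IH] L yL LB.
  by have [w [/LB[]]] := yL 1 ltr01.
have [yLB|/existsNP[e1 /not_implyP[e10 nyLB]]] := pselect (adherent y (L `&` B n)).
  by exists n.
have [||k yk] := IH (L `\` B n).
- move=> e e0; have [|w [Lw]] := yL (Num.min e e1); first by rewrite lt_min e0.
  rewrite lt_min => /andP[we we1]; exists w; split => //; split => // Bw.
  by apply: nyLB; exists w.
- move=> w [/LB[k]]; rewrite /= ltnS leq_eqVlt => /orP[/eqP-> //|kn Bk _].
  by exists k.
exists k => e /yk[w [[[Lw _] Bw] we]]; by exists w.
Qed.

(** For [y] adherent to the image, pieces of shrinking diameter are chosen inside one another with
    [y] still adherent to the image of each. Points taken in them form a Cauchy sequence, and the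
    image of its limit is [y]. *)
Lemma closed_image K : metric_closed dW K -> totally_bdd dW K ->
  metric_closed dY (q @` K).
Proof.
move=> cK tK y nqK; apply: contrapT => noball.
have yK : adherent y K.
  move=> e e0; apply: contrapT => nw; apply: noball; exists e; split => // z yz [w Kw qwz].
  by apply: nw; exists w; rewrite qwz.
have /choice[B hB] : forall j, exists B : nat -> set W,
    (forall L, adherent y L -> L `<=` K -> exists k, adherent y (L `&` B k)) /\
    forall k w w', B k w -> B k w' -> dW w w' <= 2 / j.+1%:R.
  move=> j; have [n [B [KB dB]]] := tK j; exists B; split => // L yL LK.
  by apply: (@adherent_split _ n) => // x /LK /KB.
(* The piece is chosen for every pair of a scale and a set, with 0 as a default, so that the
   recursion [Ls] carries no proofs. *)
have /choice[c hc] : forall jL : nat * set W, exists k,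
    adherent y jL.2 -> jL.2 `<=` K -> adherent y (jL.2 `&` B jL.1 k).
  move=> [j L]; have [[yL LK]|n] := pselect (adherent y L /\ L `<=` K).
    by have [k yk] := (hB j).1 L yL LK; exists k.
  by exists 0%N => yL LK; case: n.
pose Ls := fix Ls j := if j is i.+1 then Ls i `&` B i (c (i, Ls i)) else K.
have hL j : adherent y (Ls j) /\ Ls j `<=` K.
  elim: j => [|j [yL LK]]; first by split.
  split; first exact: (hc (j, Ls j)).
  by move=> w [/LK].
have LS j i : (j <= i)%N -> Ls i `<=` Ls j.
  elim: i => [|i IH]; first by rewrite leqn0 => /eqP->.
  by rewrite leq_eqVlt => /orP[/eqP->//|/IH h] w [/h].
have /choice[w hw] : forall j, exists w, Ls j w /\ dY y (q w) < j.+1%:R^-1.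
  by move=> j; apply: (hL j).1; exact: natSinv_gt0.
have [l hl] : exists l, forall e, 0 < e -> exists N, forall n, (N <= n)%N -> dW (w n) l < e.
  apply: cW => e e0; have [N Ne] : exists N : nat, N.+1%:R^-1 < e / 2.
    by apply: natSinv_lt; rewrite divr_gt0.
  exists N.+1 => m n Nm Nn; apply: (@le_lt_trans _ _ (2 / N.+1%:R)).
    have Bw i : (N < i)%N -> B N (c (N, Ls N)) (w i).
      by move=> /LS h; have [/h[]] := hw i.
    by apply: ((hB N).2 _ _ _ (Bw _ Nm) (Bw _ Nn)).
  by move: Ne; move: (_^-1) => r; lra.
apply: nqK; exists l.
  by apply: (metric_closed_lim hW cK (u := w)) => // n; have [/(hL n).2] := hw n.
apply: contrapT => ql; have := metric_dist_gt0 hY ql; set r := dY _ _ => r0.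
have [N hN] := hl (r / 2) (divr_gt0 r0 (ltr0Sn _ 1)).
have [M Mr] : exists N : nat, N.+1%:R^-1 < r / 2.
  by apply: natSinv_lt; rewrite divr_gt0.
have [_ wy] := hw (maxn N M); have wl := hN (maxn N M) (leq_maxl _ _).
have wM : (maxn N M).+1%:R^-1 <= M.+1%:R^-1 :> R.
  by rewrite lef_pV2 ?posrE// ler_nat ltnS leq_maxr.
have := metric_dist_triangle hY (q (w (maxn N M))) (q l) y; rewrite -/r.
have := q_lip (w (maxn N M)) l.
rewrite (metric_distC hY (q l)) (metric_distC hY (q (w (maxn N M))) y).
move: wM wy Mr; move: (M.+1%:R^-1) ((maxn N M).+1%:R^-1) => r1 r2.
by lra.
Qed.

End closed_image.

(** A base set separates f(z) from any other point y, so the complement of the graph is a countable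
    union of rectangles. *)
Lemma measurable_graph (R : realType) d d' (Z : measurableType d)
    (Y : measurableType d') (dY : Y -> Y -> R) (f : Z -> Y) :
  polish_metric dY -> measurable_fun setT f -> measurable [set w : Z * Y | f w.1 = w.2].
Proof.
move=> pY mf; have [hY [_ [sY _]]] := pY.
have [V [Vball Vbase]] := metric_second_countable hY sY.
have oV n : metric_open dY (V n).
  by case: (Vball n) => [-> //|[y [e ->]]]; exact: mball_open.
rewrite -(setCK [set w | _]); apply: measurableC.
have -> : ~` [set w : Z * Y | f w.1 = w.2] = \bigcup_n ((f @^-1` V n) `*` ~` V n).
  apply/seteqP; split => [[z y]/= fzy|[z y] [n _ [/= Vf Vy] fzy]]; last first.
    by apply: Vy; rewrite -fzy.
  have fz : mball dY (f z) (dY (f z) y) (f z).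
    by rewrite /mball/= (metric_dist0 hY); exact: metric_dist_gt0.
  have [n [Vz VB]] := Vbase _ (@mball_open _ _ _ hY _ _) _ fz.
  by exists n => //; split => //= /VB; rewrite /mball/= ltxx.
apply: bigcupT_measurable => n; have mV := polish_open_measurable pY (oV n).
by apply: measurableX; [exact: measurable_preimage|exact: measurableC].
Qed.

(** Since [f] need not be continuous, the approximation takes place in its graph, from which the
    projection to [Y] is 1-Lipschitz. Compact subsets of the graph over [C] have closed projections
    inside the image of [C], and countably many of them exhaust the mass. *)
Lemma image_inner (R : realType) d d' (Z : measurableType d)
    (Y : measurableType d') (P : probability Z R) (f : Z -> Y) (C : set Z) :
  polish R Z -> polish R Y -> measurable_fun setT f -> measurable C ->
  exists M, [/\ measurable M, M `<=` f @` C & P (C `\` f @^-1` M) = 0%E].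
Proof.
move=> [dZ pZ] [dY pY] mf mC.
have pW := polish_metric_prod pZ pY; have [hW [cW _]] := pW; have [hY _] := pY.
have mg : measurable_fun setT (fun z => (z, f z)) by exact: measurable_fun_pair.
pose g : {mfun Z >-> (Z * Y)%type} :=
  HB.pack (fun z => (z, f z)) (isMeasurableFun.Build _ _ _ _ _ mg).
pose Q : probability _ R := distribution P g.
pose G := [set w : Z * Y | f w.1 = w.2] `&` fst @^-1` C.
have mG : measurable G.
  by apply: measurableI; [exact: (measurable_graph pY)|exact: measurable_preimage].
have /choice[K hK] : forall n : nat, exists K, [/\ metric_closed (maxdist dZ dY) K,
    totally_bdd (maxdist dZ dY) K, K `<=` G & (Q (G `\` K) < (n.+1%:R^-1)%:E)%E].
  by move=> n; apply: (inner_compact pW) => //; exact: natSinv_gt0.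
have cK n : metric_closed dY (snd @` K n).
  have [c t _ _] := hK n; apply: (closed_image hW cW hY) => //.
  by move=> w w'; rewrite /maxdist le_max lexx orbT.
have mK n : measurable (snd @` K n) by exact: (polish_closed_measurable pY).
have mM : measurable (\bigcup_n (snd @` K n)) by exact: bigcupT_measurable.
exists (\bigcup_n (snd @` K n)); split => //.
  move=> y [n _ [[z y'] Kw <-]]; have [_ _ KG _] := hK n.
  by have [/= fz Cz] := KG _ Kw; exists z.
have mCM : measurable (C `\` f @^-1` (\bigcup_n (snd @` K n))).
  by apply: measurableD => //; exact: measurable_preimage.
apply/eqP; rewrite eq_le measure_ge0 andbT; apply/lee_addgt0Pr => e e0; rewrite add0e.
have [n ne] := natSinv_lt e0; have [c _ _ QK] := hK n.
apply: le_trans (ltW (lt_trans QK _)); last by rewrite lte_fin.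
apply: le_measure; rewrite ?inE//.
  apply: (measurable_preimage mg); apply: measurableD => //.
  exact: (polish_closed_measurable pW).
move=> z [Cz nM]; split => // Kz; apply: nM; exists n => //; by exists (z, f z).
Qed.

(* The inverse of a measurable bijection between Polish spaces is Borel by the
   Lusin-Souslin theorem; tightness gives the almost sure version, which is all
   that is needed. *)
Lemma ae_measurable_inverse (R : realType) d d' (Z : measurableType d)
    (Y : measurableType d') (P : probability Z R) (Q : probability Y R)
    (f : Z -> Y) (h : Y -> Z) :
  polish R Z -> polish R Y -> measurable_fun setT f -> cancel f h -> cancel h f ->
  (forall B, measurable B -> P (f @^-1` B) = Q B) ->
  exists (g : Y -> Z) (N : set Y), measurable_fun setT g /\ full Q N /\
    forall y, N y -> g y = h y.
Proof.
move=> pZ pY mf fK hK PQ.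
suff [g [L [mg [fL [_ gh]]]]] : exists (g : Y -> Z) (L : set Y),
    measurable_fun setT g /\ full Q L /\ L `<=` setT /\ forall y, L y -> g y = h y.
  by exists g, L.
apply: (ae_measurable pZ (fullT Q)) => B mB.
(* The preimage of [B] under [h] is the image of [B] under [f]. It contains [M1] and, by
   injectivity, misses the inner approximation [M2] of the image of the complement. *)
have [M1 [mM1 M1B PM1]] := image_inner P pZ pY mf mB.
have [M2 [mM2 M2B PM2]] := image_inner P pZ pY mf (measurableC mB).
exists (h @^-1` B), (Q M1); split => //.
exists M1, (~` M2); split => //; split; first exact: measurableC.
split; first by move=> _ /M1B[z Bz <-]; rewrite /= fK.
split; first by move=> y By /M2B[z nBz fzy]; apply: nBz; rewrite -fzy /= fK in By.
split => //; rewrite -PQ; last by apply: measurableD => //; exact: measurableC.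
have m1 := measurableD mB (measurable_preimage mf mM1).
have m2 := measurableD (measurableC mB) (measurable_preimage mf mM2).
apply: (subset_measure0 (B := (B `\` f @^-1` M1) `|` (~` B `\` f @^-1` M2))).
- by apply: measurable_preimage => //; apply: measurableD => //; exact: measurableC.
- exact: measurableU.
- by move=> z [nM2 nM1]; have [Bz|nBz] := pselect (B z); [left|right].
- apply/eqP; rewrite eq_le measure_ge0 andbT.
  by apply: le_trans (measureU2 _ m1 m2) _;
    rewrite [X in (X + _ <= _)%E]PM1 [X in (_ + X <= _)%E]PM2 adde0.
Qed.

(** * The lattice *)

(** Column [j] is computed upwards from its bottom value and from all carriers entering it on the
    left; the carriers leaving it feed column j+1. *)
Lemma quarter_plane (Z W : Type) (F : nat -> nat -> Z * W -> Z * W)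
    (z0 : nat -> Z) (w0 : nat -> W) :
  exists (z : nat -> nat -> Z) (w : nat -> nat -> W),
    (forall j, z j 0%N = z0 j) /\ (forall t, w 0%N t = w0 t) /\
    forall j t, F j t (z j t, w j t) = (z j t.+1, w j.+1 t).
Proof.
pose col j (v : nat -> W) := fix col t :=
  if t is s.+1 then (F j s (col s, v s)).1 else z0 j.
pose w := fix w j := if j is i.+1
  then fun t => (F i t (col i (w i) t, w i t)).2 else w0.
exists (fun j => col j (w j)), w; split=> [j //|]; split=> [t //|j t].
by rewrite [RHS]/=; case: (F j t _).
Qed.

Section lattice.
Context (X Xt U Ut : Type) (Fs : X * U -> Xt * Ut).

Record lattice := Lattice {
  lxe : int -> int -> X; lxo : int -> int -> Xt;
  lue : int -> int -> Ut; luo : int -> int -> U }.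

Implicit Types (S : lattice) (y : int -> X * Xt).

Definition solves S y := solvesII Fs y (lxe S) (lxo S) (lue S) (luo S).

Definition same S S' := same_latticeII (lxe S) (lxo S) (lue S) (luo S)
  (lxe S') (lxo S') (lue S') (luo S').

Lemma XstarII_lattice y : XstarII Fs y <->
  exists S, solves S y /\ forall S', solves S' y -> same S S'.
Proof.
split => [[xe [xo [ue [uo [s u]]]]]|[[xe xo ue uo] [s u]]].
  by exists (Lattice xe xo ue uo); split => // -[xe' xo' ue' uo'] /u.
exists xe, xo, ue, uo; split => // xe' xo' ue' uo' s'.
exact: (u (Lattice xe' xo' ue' uo')).
Qed.

Lemma XstarII_same y S S' : XstarII Fs y -> solves S y -> solves S' y -> same S S'.
Proof.
move=> /XstarII_lattice[S0 [_ u]] /u h /u h' n t.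
have [he ho] := h n t; have [he' ho'] := h' n t.
by split=> nt; [have [<- <-] := he nt; exact: he'|have [<- <-] := ho nt; exact: ho'].
Qed.

Definition shift (k : int) y : int -> X * Xt := fun j => y (j + k).

Definition shift_lattice (k : int) S := Lattice
  (fun n => lxe S (n + 2 * k)) (fun n => lxo S (n + 2 * k))
  (fun n => lue S (n + 2 * k)) (fun n => luo S (n + 2 * k)).

Lemma solves_shift k S y : solves S y -> solves (shift_lattice k S) (shift k y).
Proof.
move=> [s1 [s2 s3]]; split=> [n t nt /=|].
  have -> : n - 1 + 2 * k = n + 2 * k - 1 by lia.
  by rewrite s1//; lia.
split=> [n t nt /=|j /=].
  have -> : n - 1 + 2 * k = n + 2 * k - 1 by lia.
  by rewrite s2//; lia.
have -> : 2 * j + 2 * k = 2 * (j + k) by lia.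
have -> : 2 * j + 1 + 2 * k = 2 * (j + k) + 1 by lia.
exact: s3.
Qed.

(* Space-time reversal: x_n^t becomes x_{-n}^{-t}, u_n^t becomes u_{-n-1}^{-t-1}. *)
Definition reversal y : int -> X * Xt := fun k => ((y (- k)).1, (y (- k - 1)).2).

Definition reversal_lattice S := Lattice
  (fun n t => lxe S (- n) (- t)) (fun n t => lxo S (- n) (- t))
  (fun n t => lue S (- n - 1) (- t - 1)) (fun n t => luo S (- n - 1) (- t - 1)).

(** The reversed equation at (n, t) is the original one at (-n, -t-1), a point of the other parity;
    thus reversal exchanges [Fs] with its inverse. *)
Lemma solves_reversal S y : solves S y -> solves (reversal_lattice S) (reversal y).
Proof.
move=> [s1 [s2 s3]]; split=> [n t nt /=|].
  have -> : - (n - 1) - 1 = - n by lia.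
  have -> : - (t + 1) = - t - 1 by lia.
  rewrite s2; last by lia.
  by have -> : - t - 1 + 1 = - t by lia.
split=> [n t nt /=|j /=].
  have -> : - (n - 1) - 1 = - n by lia.
  have -> : - (t + 1) = - t - 1 by lia.
  rewrite s1; last by lia.
  by have -> : - t - 1 + 1 = - t by lia.
rewrite oppr0; have -> : - (2 * j) = 2 * - j by lia.
have -> : - (2 * j + 1) = 2 * (- j - 1) + 1 by lia.
by split; [exact: (s3 (- j)).1|exact: (s3 (- j - 1)).2].
Qed.

Definition step S : int -> X * Xt := fun k => (lxe S (2 * k + 1) 1, lxo S (2 * k + 2) 1).

(** Moving by one in both n and t keeps the parity of n + t, hence the type of every variable. *)
Definition step_lattice S := Lattice
  (fun n t => lxe S (n + 1) (t + 1)) (fun n t => lxo S (n + 1) (t + 1))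
  (fun n t => lue S (n + 1) (t + 1)) (fun n t => luo S (n + 1) (t + 1)).

Lemma solves_step S y : solves S y -> solves (step_lattice S) (step S).
Proof.
move=> [s1 [s2 _]]; split=> [n t nt /=|].
  have -> : n - 1 + 1 = n + 1 - 1 by lia.
  by rewrite s1//; lia.
split=> [n t nt /=|j /=].
  have -> : n - 1 + 1 = n + 1 - 1 by lia.
  by rewrite s2//; lia.
by split => //; congr (lxo S _ _); lia.
Qed.

(* If the time-one configuration also lies in X^*, the reversed dynamics started
   from it retraces the carrier. *)
Lemma lue_reversal_step S S' y : solves S y -> XstarII Fs (reversal (step S)) ->
  solves S' (reversal (step S)) -> lue S' 0 0 = lue S 0 0.
Proof.
move=> /solves_step/solves_reversal s r /(XstarII_same r s)/(_ 0 0)[/(_ isT)[_ /= <-] _].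
by [].
Qed.

Definition agree_upto (N : int) y y' := forall k : int,
  (2 * k <= N -> (y k).1 = (y' k).1) /\ (2 * k + 1 <= N -> (y k).2 = (y' k).2).

Hypothesis Fbij : bijective Fs.

(** A lattice over [y'] is glued from [S'] below time 0, [S] to the left for t >= 0, and a freshly
    solved quarter plane on the right. Uniqueness for [y'] identifies it with [S'], so [S] and [S']
    agree on the left. *)
Lemma nonanticipating N S S' y y' : XstarII Fs y' -> solves S y -> solves S' y' ->
  agree_upto N y y' -> forall n t : int, n <= N -> 0 <= t ->
  ((2 %| n + t)%Z -> lxe S n t = lxe S' n t /\ lue S n t = lue S' n t) /\
  (~~ (2 %| n + t)%Z -> lxo S n t = lxo S' n t /\ luo S n t = luo S' n t).
Proof.
case: Fbij => h FK hK yX [s1 [s2 s3]] s' yy'; have [s1' [s2' s3']] := s'.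
pose site (j : nat) : int := N + 1 + j.
(* Column 0 is site N+1, fed by the carriers of [S] leaving site [N]. Both variable types travel as
   a pair, and the component that is meaningless at the current parity is merely copied. *)
have [z [w [hz [hw hF]]]] := @quarter_plane (X * Xt) (Ut * U)
  (fun j t zw => if (2 %| site j + t)%Z
     then let p := Fs (zw.1.1, zw.2.2) in ((zw.1.1, p.1), (p.2, zw.2.2))
     else let p := h (zw.1.2, zw.2.1) in ((p.1, zw.1.2), (zw.2.1, p.2)))
  (fun j => (lxe S' (site j) 0, lxo S' (site j) 0))
  (fun t => (lue S N t, luo S N t)).
(* The switch is at t <= 0 for x but at t < 0 for u: an equation at time t involves x at t and t+1
   and u at t. On row 0 up to [N] the two sources agree by [yy']. *)
pose xz (n t : int) := if t <= 0 then (lxe S' n t, lxo S' n t)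
  else if n <= N then (lxe S n t, lxo S n t) else z (absz (n - N - 1)%R) (absz t).
pose uw (n t : int) := if t < 0 then (lue S' n t, luo S' n t)
  else if n <= N then (lue S n t, luo S n t) else w (absz (n - N)%R) (absz t).
have past_x n (t : int) : t <= 0 -> xz n t = (lxe S' n t, lxo S' n t).
  by rewrite /xz => ->.
have past_u n (t : int) : t < 0 -> uw n t = (lue S' n t, luo S' n t).
  by rewrite /uw => ->.
have old_xe (n t : int) : n <= N -> 0 <= t -> (2 %| n + t)%Z -> (xz n t).1 = lxe S n t.
  move=> nN t0 nt; rewrite /xz nN; case: ifPn => // t0'.
  have tE : t = 0 by lia.
  have [k nE] : exists k, n = 2 * k by exists (n %/ 2)%Z; lia.
  rewrite tE nE /=; have [-> _] := s3 k; have [-> _] := s3' k.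
  by symmetry; apply: (proj1 (yy' k)); lia.
have old_xo (n t : int) : n <= N -> 0 <= t -> ~~ (2 %| n + t)%Z -> (xz n t).2 = lxo S n t.
  move=> nN t0 nt; rewrite /xz nN; case: ifPn => // t0'.
  have tE : t = 0 by lia.
  have [k nE] : exists k, n = 2 * k + 1 by exists (n %/ 2)%Z; lia.
  rewrite tE nE /=; have [_ ->] := s3 k; have [_ ->] := s3' k.
  by symmetry; apply: (proj2 (yy' k)); lia.
have old_u (n t : int) : n <= N -> 0 <= t -> uw n t = (lue S n t, luo S n t).
  by move=> nN t0; rewrite /uw nN ltNge t0.
have new_x (n t : int) : N < n -> 0 <= t -> xz n t = z (absz (n - N - 1)%R) (absz t).
  move=> nN t0; rewrite /xz (leNgt n) nN /=; case: ifPn => // t0'.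
  have -> : t = 0 by lia.
  by rewrite hz; have -> : site (absz (n - N - 1)%R) = n by rewrite /site; lia.
have new_u (n t : int) : N <= n -> 0 <= t -> uw n t = w (absz (n - N)%R) (absz t).
  move=> nN t0; rewrite /uw ltNge t0/=; case: ifPn => // nN'.
  have -> : n = N by lia.
  by rewrite subrr hw; have -> : ((absz t) : int) = t by lia.
have idx (n t : int) : N < n -> 0 <= t ->
    [/\ (absz (n - 1 - N)%R) = (absz (n - N - 1)%R), (absz (n - N)%R) = (absz (n - N - 1)%R).+1,
        (absz (t + 1)%R) = (absz t).+1 & site (absz (n - N - 1)%R) + (absz t) = n + t].
  by move=> nN t0; rewrite /site; split; lia.
clearbody xz uw.
have s'' : solves (Lattice (fun n t => (xz n t).1) (fun n t => (xz n t).2)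
    (fun n t => (uw n t).1) (fun n t => (uw n t).2)) y'.
  split=> [n t nt /=|].
    have [t0|t0] := ltP t 0; first by rewrite !past_x ?past_u ?s1'//; lia.
    have [nN|nN] := leP n N.
      by rewrite old_xe// old_xo ?old_u ?s1//; lia.
    rewrite !new_x ?new_u; try lia.
    have [-> -> -> st] := idx n t nN t0.
    by have := hF (absz (n - N - 1)%R) (absz t); rewrite st nt /= => -[<- <-] /=; case: (Fs _).
  split=> [n t nt /=|k /=]; last by rewrite !past_x//; exact: s3'.
  have [t0|t0] := ltP t 0; first by rewrite !past_x ?past_u ?s2'//; lia.
  have [nN|nN] := leP n N.
    by rewrite old_xo// old_xe ?old_u ?s2//; lia.
  rewrite !new_x ?new_u; try lia.
  have [-> -> -> st] := idx n t nN t0.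
  have := hF (absz (n - N - 1)%R) (absz t); rewrite st (negbTE nt) /= => -[<- <-] /=.
  by rewrite -surjective_pairing hK.
move=> n t nN t0; have [/= he ho] := XstarII_same yX s'' s' n t.
split=> nt; [have [<- <-] := he nt|have [<- <-] := ho nt].
  by rewrite old_xe// old_u.
by rewrite old_xo// old_u.
Qed.

End lattice.

(** * Product laws on configurations *)

Lemma prode_extend (R : realType) (s w : seq int) (F G : int -> \bar R) :
  uniq s -> uniq w -> {subset s <= w} ->
  {in s, F =1 G} -> (forall k, k \notin s -> F k = 1%E) ->
  (\prod_(k <- w) F k = \prod_(k <- s) G k)%E.
Proof.
move=> us uw sw FG F1; rewrite (bigID (mem s))/= [X in (_ * X)%E]big1 ?mule1; last first.
  by move=> k ks; exact: F1.
rewrite -big_filter (perm_big s)/=.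
  by rewrite big_seq [RHS]big_seq; apply: eq_bigr => k /FG.
apply: uniq_perm => //; first exact: filter_uniq.
by move=> k; rewrite mem_filter; apply/andb_idr => /sw.
Qed.

Definition window (a : int) (n : nat) : seq int := mkseq (fun i => a + i%:Z) n.

Section configII_law.
Context (R : realType) (d d' : measure_display) (X : measurableType d)
  (Xt : measurableType d').
Variables (mu : probability X R) (mut : probability Xt R).
Notation config := (configII X Xt).

Definition cyl (s : seq int) (A : int -> set X) (B : int -> set Xt) : set config :=
  [set y | forall k, k \in s -> A k (y k).1 /\ B k (y k).2].

Lemma measurable_even k : measurable_fun setT (fun y : config => (y k).1).
Proof.
move=> _ A mA; rewrite setTI; apply: sub_sigma_algebra; left.
by exists k, A.
Qed.

Lemma measurable_odd k : measurable_fun setT (fun y : config => (y k).2).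
Proof.
move=> _ A mA; rewrite setTI; apply: sub_sigma_algebra; right.
by exists k, A.
Qed.

Lemma measurable_configP d0 (T : measurableType d0) (f : T -> config) :
  (forall k, measurable_fun setT (fun w => (f w k).1)) ->
  (forall k, measurable_fun setT (fun w => (f w k).2)) ->
  measurable_fun setT f.
Proof.
move=> m1 m2; apply: (@measurability _ _ T config setT f (@cylII _ _ X Xt)) => //.
move=> _ [_ [] [k [A [mA ->]]] <-].
  by rewrite setTI; exact: (measurable_preimage (m1 k)).
by rewrite setTI; exact: (measurable_preimage (m2 k)).
Qed.

Lemma measurable_cyl s A B : (forall k, measurable (A k)) -> (forall k, measurable (B k)) ->
  measurable (cyl s A B).
Proof.
move=> mA mB.
have -> : cyl s A B = \bigcap_(k in [set` s])
    ((fun y : config => (y k).1) @^-1` A k `&` (fun y : config => (y k).2) @^-1` B k).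
  by apply/seteqP; split => y h k ks; exact: h.
apply: fin_bigcap_measurable => // k _; apply: measurableI.
  exact: (measurable_preimage (measurable_even k)).
exact: (measurable_preimage (measurable_odd k)).
Qed.

Lemma configII_law_unique d0 (T : measurableType d0) (P : probability T R)
    (Q : probability config R) (f : T -> config) :
  measurable_fun setT f -> iid_lawII mu mut (fun C => P (f @^-1` C)) ->
  iid_lawII mu mut Q -> forall C, measurable C -> P (f @^-1` C) = Q C.
Proof.
move=> mf lP lQ C mC.
pose G : set (set config) := [set C | exists s A B, [/\ uniq s,
  forall k, measurable (A k), forall k, measurable (B k) & C = cyl s A B]].
have mG : @measurable _ config = <<s G >>.
  apply/seteqP; split; apply: smallest_sub.
  - exact: smallest_sigma_algebra.
  - move=> _ [] [k [A [mA ->]]]; apply: sub_sigma_algebra.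
      exists [:: k], (fun=> A), (fun=> setT); split => //.
      apply/seteqP; split => y /=; first by move=> Ay j; rewrite inE => /eqP->.
      by move=> /(_ k)[]//; rewrite inE.
    exists [:: k], (fun=> setT), (fun=> A); split => //.
    apply/seteqP; split => y /=; first by move=> Ay j; rewrite inE => /eqP->.
    by move=> /(_ k)[]//; rewrite inE.
  - exact: smallest_sigma_algebra.
  - by move=> _ [s [A [B [us mA mB ->]]]]; exact: measurable_cyl.
have GI : setI_closed G.
  move=> _ _ [s [A [B [us mA mB ->]]]] [s' [A' [B' [us' mA' mB' ->]]]].
  (* Outside its own list a cylinder imposes no condition, so its sets are replaced by the whole
     space there before intersecting. *)
  pose cut (Y : Type) (t : seq int) (D : int -> set Y) (k : int) : set Y :=
    if k \in t then D k else setT.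
  have mcut e (Y : measurableType e) (t : seq int) (D : int -> set Y) k :
    (forall k, measurable (D k)) -> measurable (cut (Measurable.sort Y) t D k).
    by rewrite /cut => mD; case: ifP.
  exists (undup (s ++ s')), (fun k => cut _ s A k `&` cut _ s' A' k),
    (fun k => cut _ s B k `&` cut _ s' B' k); split.
  - exact: undup_uniq.
  - by move=> k; apply: measurableI; exact: mcut.
  - by move=> k; apply: measurableI; exact: mcut.
  apply/seteqP; split => y.
    move=> [h h'] k _; rewrite /cut; split; split; case: ifP => // ks.
    - exact: (h k ks).1.
    - exact: (h' k ks).1.
    - exact: (h k ks).2.
    - exact: (h' k ks).2.
  move=> h; split => k ks; have [] := h k; rewrite ?mem_undup ?mem_cat ?ks ?orbT//;
    by rewrite /cut ks => -[? ?] [? ?].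
have := @law_unique _ _ _ T config P Q G f setT mG GI mf measurableT.
have -> : P setT = 1%E by exact: probability_setT.
move=> /(_ _ _ mC); rewrite setTI mul1e; apply => _ [s [A [B [us mA mB ->]]]].
by rewrite setTI mul1e lQ// -(lP _ _ _ us mA mB).
Qed.

(** Every finite set of indices lies in a block symmetric about 0, and the added indices contribute
    factors 1. Blocks are what the induction along sites produces. *)
Lemma iid_lawII_window (m : set config -> \bar R) :
  (forall (a : int) (n : nat) A B,
     (forall k, measurable (A k)) -> (forall k, measurable (B k)) ->
     m (cyl (window a n) A B) =
     (\prod_(k <- window a n) (mu (A k) * mut (B k)))%E) ->
  iid_lawII mu mut m.
Proof.
move=> h s A B us mA mB.
pose M := \max_(k <- s) absz k.
have sM k : k \in s -> (absz k <= M)%N by move=> ks; exact: leq_bigmax_seq.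
pose A' k := if k \in s then A k else setT.
pose B' k := if k \in s then B k else setT.
pose w := window (- M%:Z) M.*2.+1.
have sw : {subset s <= w}.
  move=> k /sM kM; apply/mapP; exists (absz (k + M)%R); last by lia.
  by rewrite mem_iota; lia.
have mA' k : measurable (A' k) by rewrite /A'; case: ifP.
have mB' k : measurable (B' k) by rewrite /B'; case: ifP.
have := h (- M%:Z) M.*2.+1 A' B' mA' mB'; rewrite -/w.
rewrite (@prode_extend _ s w _ (fun k => mu (A k) * mut (B k))%E)//; last 3 first.
- by apply: mkseq_uniq => i j; lia.
- by move=> k ks; rewrite /A' /B' ks.
- by move=> k /negbTE ks; rewrite /A' /B' ks !probability_setT mule1.
move=> <-; congr m; apply/seteqP; split => y hy k ks.
  by rewrite /A' /B'; case: ifP => // /hy.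
by have := hy k (sw _ ks); rewrite /A' /B' ks.
Qed.

Variable P : probability config R.
Hypothesis lawP : iid_lawII mu mut P.

(** Even and odd sites get separate index lists, because reversal sends the two members of a pair
    into different pairs. *)
Lemma iid_lawII_split (s1 s2 : seq int) A B : uniq s1 -> uniq s2 ->
  (forall k, measurable (A k)) -> (forall k, measurable (B k)) ->
  P [set y : config | (forall k, k \in s1 -> A k (y k).1) /\
                      (forall k, k \in s2 -> B k (y k).2)] =
  (\prod_(k <- s1) mu (A k) * \prod_(k <- s2) mut (B k))%E.
Proof.
move=> u1 u2 mA mB.
pose A' k := if k \in s1 then A k else setT.
pose B' k := if k \in s2 then B k else setT.
have mA' k : measurable (A' k) by rewrite /A'; case: ifP.
have mB' k : measurable (B' k) by rewrite /B'; case: ifP.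
have := lawP (undup_uniq (s1 ++ s2)) mA' mB'.
rewrite big_split/= (@prode_extend _ s1 _ (fun k => mu (A' k)) (fun k => mu (A k)))//; last 4 first.
- exact: undup_uniq.
- by move=> k ks; rewrite mem_undup mem_cat ks.
- by move=> k ks; rewrite /A' ks.
- by move=> k /negbTE ks; rewrite /A' ks probability_setT.
rewrite (@prode_extend _ s2 _ (fun k => mut (B' k)) (fun k => mut (B k)))//; last 4 first.
- exact: undup_uniq.
- by move=> k ks; rewrite mem_undup mem_cat ks orbT.
- by move=> k ks; rewrite /B' ks.
- by move=> k /negbTE ks; rewrite /B' ks probability_setT.
move=> <-; congr (P _); apply/seteqP; split => y.
  by move=> [h1 h2] k _; rewrite /A' /B'; split; case: ifP => //; [exact: h1|exact: h2].
move=> h; split => k ks; have := h k; rewrite mem_undup mem_cat ks ?orbT /A' /B' ks.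
  by move=> /(_ isT)[].
by move=> /(_ isT)[].
Qed.

Lemma measurable_shift k : measurable_fun setT (shift k : config -> config).
Proof. by apply: measurable_configP => j; [exact: measurable_even|exact: measurable_odd]. Qed.

Lemma shift_law k C : measurable C -> P ((shift k : config -> config) @^-1` C) = P C.
Proof.
move=> mC; apply: (configII_law_unique (@measurable_shift k) _ lawP mC).
move=> s A B us mA mB.
have := @lawP (map (fun j => j + k) s) (fun j => A (j - k)) (fun j => B (j - k)).
rewrite big_map; under eq_bigr do rewrite addrK.
rewrite map_inj_uniq; last exact: addIr.
move=> <-//; congr (P _); apply/seteqP; split => y h j.
  by move=> /mapP[i /h + ->]; rewrite addrK.
by move=> js; have := h (j + k); rewrite addrK; apply; exact: map_f.
Qed.

Lemma measurable_reversal : measurable_fun setT (@reversal X Xt : config -> config).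
Proof. by apply: measurable_configP => j; [exact: measurable_even|exact: measurable_odd]. Qed.

Lemma reversal_law C : measurable C -> P ((@reversal X Xt : config -> config) @^-1` C) = P C.
Proof.
move=> mC; apply: (configII_law_unique measurable_reversal _ lawP mC).
move=> s A B us mA mB.
have i1 : injective (fun k : int => - k) by exact: oppr_inj.
have i2 : injective (fun k : int => - k - 1) by move=> i j; lia.
have := @iid_lawII_split (map (fun k => - k) s) (map (fun k => - k - 1) s)
  (fun k => A (- k)) (fun k => B (- k - 1)).
rewrite !map_inj_uniq// !big_map.
under eq_bigr do rewrite opprK.
under [in X in (_ * X)%E]eq_bigr => k _ do (rewrite (_ : - (- k - 1) - 1 = k); last by lia).
rewrite -big_split/= => <-//; congr (P _); apply/seteqP; split => y.
  move=> h; split => k /mapP[j /h[/= Aj Bj] ->]; first by rewrite opprK.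
  by rewrite (_ : - (- j - 1) - 1 = j)//; lia.
move=> [h1 h2] k ks; split => /=.
  by have := h1 (- k); rewrite opprK; apply; exact: map_f.
have := h2 (- k - 1); rewrite (_ : - (- k - 1) - 1 = k); last by lia.
by apply; apply/mapP; exists k.
Qed.

Definition resample_even (k : int) (w : config * X) : config :=
  fun j => if j == k then (w.2, (w.1 j).2) else w.1 j.

Definition resample_odd (k : int) (w : config * Xt) : config :=
  fun j => if j == k then ((w.1 j).1, w.2) else w.1 j.

Lemma measurable_resample_even k : measurable_fun setT (resample_even k).
Proof.
apply: measurable_configP => j; rewrite /resample_even; case: (j == k) => /=.
- exact: measurable_snd.
- by apply: (measurableT_comp (measurable_even j)); exact: measurable_fst.
- by apply: (measurableT_comp (measurable_odd j)); exact: measurable_fst.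
- by apply: (measurableT_comp (measurable_odd j)); exact: measurable_fst.
Qed.

Lemma measurable_resample_odd k : measurable_fun setT (resample_odd k).
Proof.
apply: measurable_configP => j; rewrite /resample_odd; case: (j == k) => /=.
- by apply: (measurableT_comp (measurable_even j)); exact: measurable_fst.
- by apply: (measurableT_comp (measurable_even j)); exact: measurable_fst.
- exact: measurable_snd.
- by apply: (measurableT_comp (measurable_odd j)); exact: measurable_fst.
Qed.

Lemma resample_even_law k C : measurable C ->
  (P \x mu)%E (resample_even k @^-1` C) = P C.
Proof.
move=> mC; apply: (configII_law_unique (P := (P \x mu)%E) (measurable_resample_even k) _ lawP mC).
move=> s A B us mA mB.
pose A' j := if j == k then setT else A j.
have mA' j : measurable (A' j) by rewrite /A'; case: ifP.
pose D := if k \in s then A k else setT.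
have mD : measurable D by rewrite /D; case: ifP.
have -> : resample_even k @^-1` [set y : config | forall k, k \in s -> A k (y k).1 /\ B k (y k).2]
    = cyl s A' B `*` D.
  apply/seteqP; split => -[y z] /=.
    move=> h; split => /= [j /h|]; rewrite /resample_even /A' /D;
      first by case: ifP => [/eqP-> []|].
    by case: ifP => // /h[]; rewrite ?/resample_even ?/resample_odd eqxx.
  move=> [/= h Dz] j js; have := h j js; rewrite /resample_even /A'; case: ifP => // /eqP jk [_ Bj].
  by split => //=; move: Dz; rewrite /D -jk js.
transitivity (P (cyl s A' B) * mu D)%E.
  by apply: product_measure1E => //; exact: measurable_cyl.
rewrite [X in (X * _)%E](lawP us mA' mB) /D; case: ifPn => ks; last first.
  rewrite probability_setT mule1 big_seq [RHS]big_seq; apply: eq_bigr => j js.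
  by rewrite /A'; case: eqP => // jk; rewrite -jk js in ks.
rewrite (bigD1_seq k)//= [RHS](bigD1_seq k)//= /A' eqxx probability_setT mul1e.
rewrite (eq_bigr (fun j => mu (A j) * mut (B j))%E) => [|j /negbTE->//].
by rewrite muleC muleA.
Qed.

Lemma resample_odd_law k C : measurable C ->
  (P \x mut)%E (resample_odd k @^-1` C) = P C.
Proof.
move=> mC; apply: (configII_law_unique (P := (P \x mut)%E) (measurable_resample_odd k) _ lawP mC).
move=> s A B us mA mB.
pose B' j := if j == k then setT else B j.
have mB' j : measurable (B' j) by rewrite /B'; case: ifP.
pose D := if k \in s then B k else setT.
have mD : measurable D by rewrite /D; case: ifP.
have -> : resample_odd k @^-1` [set y : config | forall k, k \in s -> A k (y k).1 /\ B k (y k).2]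
    = cyl s A B' `*` D.
  apply/seteqP; split => -[y z] /=.
    move=> h; split => /= [j /h|]; rewrite /resample_odd /B' /D;
      first by case: ifP => [/eqP-> []|].
    by case: ifP => // /h[]; rewrite ?/resample_even ?/resample_odd eqxx.
  move=> [/= h Dz] j js; have := h j js; rewrite /resample_odd /B'; case: ifP => // /eqP jk [Aj _].
  by split => //=; move: Dz; rewrite /D -jk js.
transitivity (P (cyl s A B') * mut D)%E.
  by apply: product_measure1E => //; exact: measurable_cyl.
rewrite [X in (X * _)%E](lawP us mA mB') /D; case: ifPn => ks; last first.
  rewrite probability_setT mule1 big_seq [RHS]big_seq; apply: eq_bigr => j js.
  by rewrite /B'; case: eqP => // jk; rewrite -jk js in ks.
rewrite (bigD1_seq k)//= [RHS](bigD1_seq k)//= /B' eqxx probability_setT mule1.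
rewrite (eq_bigr (fun j => mu (A j) * mut (B j))%E) => [|j /negbTE->//].
by rewrite -!muleA [X in (_ * X)%E]muleC.
Qed.

End configII_law.

(** * Type II *)

Lemma polish_prod (R : realType) d d' (X : measurableType d) (Y : measurableType d') :
  polish R X -> polish R Y -> polish R (X * Y)%type.
Proof. by move=> [d1 p1] [d2 p2]; exists (maxdist d1 d2); exact: polish_metric_prod. Qed.

Section typeII.
Context (R : realType) (dX dXt dU dUt : measure_display).
Context (X0 : measurableType dX) (Xt0 : measurableType dXt)
  (U0 : measurableType dU) (Ut0 : measurableType dUt).
Variables (Fs : X0 * U0 -> Xt0 * Ut0).
Variables (mu : probability X0 R) (mut : probability Xt0 R)
  (nu : probability U0 R) (nut : probability Ut0 R)
  (P : probability (configII X0 Xt0) R).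
Hypotheses (pU : polish R U0) (pUt : polish R Ut0).
Hypotheses (mF : measurable_fun setT Fs) (Fbij : bijective Fs).
Hypothesis lawP : iid_lawII mu mut P.
Notation config := (configII X0 Xt0).
Notation sol := (config -> lattice X0 Xt0 U0 Ut0).

Section carrier.
Hypothesis Xstar1 : cmeasure_is P (XstarII Fs) 1%E.
Hypothesis nuE : forall B, measurable B -> cmeasure_is P (Um1_preII Fs B) (nu B).
Hypothesis nutE : forall B, measurable B -> cmeasure_is P (U0_preII Fs B) (nut B).

(** The solution [S y] comes from the axiom of choice; measurability is recovered only for the two
    carriers [go] and [ge], through the laws assumed for them. *)
Lemma carrier_version : exists (S : sol) (K : set config) (go : config -> U0) (ge : config -> Ut0),
  [/\ full P K /\ forall y, K y -> XstarII Fs y /\ solves Fs (S y) y,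
      measurable_fun setT go /\ forall y, K y -> go y = luo (S y) (-1) 0,
      measurable_fun setT ge /\ forall y, K y -> ge y = lue (S y) 0 0,
      forall B, measurable B -> P (go @^-1` B) = nu B &
      forall B, measurable B -> P (ge @^-1` B) = nut B].
Proof.
have [K0 [M2 [mK0 [_ [K0X [_ [_ PK0]]]]]]] := Xstar1.
have fK0 : full P K0 by [].
have [y0 K0y0] : K0 !=set0.
  by apply/set0P/eqP => K00; move/eqP: PK0; rewrite K00 measure0 eq_sym onee_eq0.
have /XstarII_lattice[S0 _] := K0X _ K0y0.
(* [S0], obtained from a point of the full set [K0], is the default value off [XstarII Fs]. *)
have /choice[S HS] : forall y, exists S, XstarII Fs y -> solves Fs S y.
  move=> y; have [/XstarII_lattice[S [s _]]|nX] := pselect (XstarII Fs y); first by exists S.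
  by exists S0.
have preo B y : K0 y -> Um1_preII Fs B y <-> B (luo (S y) (-1) 0).
  move=> /K0X Xy; have sy := HS y Xy; split; last first.
    by move=> BS; split => //; exists (lxe (S y)), (lxo (S y)), (lue (S y)), (luo (S y)).
  move=> [_ [xe [xo [ue [uo [s Bu]]]]]].
  have [_ /(_ isT)[_ <-]//] :=
    @XstarII_same _ _ _ _ Fs y (Lattice xe xo ue uo) (S y) Xy s sy (-1) 0.
have pree B y : K0 y -> U0_preII Fs B y <-> B (lue (S y) 0 0).
  move=> /K0X Xy; have sy := HS y Xy; split; last first.
    by move=> BS; split => //; exists (lxe (S y)), (lxo (S y)), (lue (S y)), (luo (S y)).
  move=> [_ [xe [xo [ue [uo [s Bu]]]]]].
  have [/(_ isT)[_ <-]//] := @XstarII_same _ _ _ _ Fs y (Lattice xe xo ue uo) (S y) Xy s sy 0 0.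
have [|go [Lo [mgo [fLo [LoK goE]]]]] :=
  @ae_measurable R _ _ _ _ P (fun y => luo (S y) (-1) 0) K0 pU fK0.
  by move=> B mB; exists (Um1_preII Fs B), (nu B); split; [exact: nuE|exact: preo].
have [|ge [Le [mge [fLe [LeK geE]]]]] :=
  @ae_measurable R _ _ _ _ P (fun y => lue (S y) 0 0) K0 pUt fK0.
  by move=> B mB; exists (U0_preII Fs B), (nut B); split; [exact: nutE|exact: pree].
have fL := fullI fLo fLe.
exists S, (Lo `&` Le), go, ge; split.
- by split => // y [/LoK/K0X Xy _]; split => //; exact: HS.
- by split => // y [/goE].
- by split => // y [_ /geE].
- move=> B mB; apply: (cmeasure_full (nuE mB) fL); first exact: measurable_preimage.
  by move=> y [Loy _]; rewrite preo /preimage/= ?goE//; exact: LoK.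
- move=> B mB; apply: (cmeasure_full (nutE mB) fL); first exact: measurable_preimage.
  by move=> y [_ Ley]; rewrite pree /preimage/= ?geE//; exact: LeK.
Qed.

End carrier.

(** The odd entry of pair [k] is site 2k+1, so an event decided by the sites up to 2k is not
    affected by resampling it. *)
Lemma indep_odd (K E : set config) k A : full P K -> measurable E ->
  (forall y y', K y -> K y' -> agree_upto (2 * k) y y' -> E y <-> E y') ->
  measurable A -> P (E `&` (fun y : config => (y k).2) @^-1` A) = (P E * mut A)%E.
Proof.
move=> fK mE KE mA.
apply: (@resampling_indep _ _ _ _ _ P mut (fun y : config => (y k).2) (@resample_odd _ _ _ _ k) K E
  (@measurable_resample_odd _ _ _ _ k) (@measurable_odd _ _ _ _ k)) => //.
- by move=> [y z]; rewrite /resample_odd eqxx.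
- by move=> C mC; exact: (resample_odd_law lawP).
move=> [y z] /= Ky Ky'; apply: KE => // j; rewrite /resample_odd.
by case: eqP => // ->; split => // ?; exfalso; lia.
Qed.

Lemma indep_even (K E : set config) k A : full P K -> measurable E ->
  (forall y y', K y -> K y' -> agree_upto (2 * k - 1) y y' -> E y <-> E y') ->
  measurable A -> P (E `&` (fun y : config => (y k).1) @^-1` A) = (P E * mu A)%E.
Proof.
move=> fK mE KE mA.
apply: (@resampling_indep _ _ _ _ _ P mu (fun y : config => (y k).1) (@resample_even _ _ _ _ k) K E
  (@measurable_resample_even _ _ _ _ k) (@measurable_even _ _ _ _ k)) => //.
- by move=> [y z]; rewrite /resample_even eqxx.
- by move=> C mC; exact: (resample_even_law lawP).
move=> [y z] /= Ky Ky'; apply: KE => // j; rewrite /resample_even.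
by case: eqP => // ->; split => // ?; exfalso; lia.
Qed.

(** * Joint law of a site and its incoming carrier; the direct implication *)

Section invariance.
Variables (S : sol) (K : set config) (go : config -> U0) (ge : config -> Ut0).
Hypothesis fK : full P K.
Hypothesis KS : forall y, K y -> XstarII Fs y /\ solves Fs (S y) y.
Hypotheses (mgo : measurable_fun setT go) (mge : measurable_fun setT ge).
Hypothesis goE : forall y, K y -> go y = luo (S y) (-1) 0.
Hypothesis geE : forall y, K y -> ge y = lue (S y) 0 0.
Hypothesis go_law : forall B, measurable B -> P (go @^-1` B) = nu B.
Hypothesis ge_law : forall B, measurable B -> P (ge @^-1` B) = nut B.

Lemma joint_odd D : measurable D ->
  P [set y : config | D ((y 0).2, ge y)] = (mut \x nut)%E D.
Proof.
move=> mD.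
have := @law_unique_prod _ _ _ _ _ _ _ P mut nut (fun y : config => (y 0).2) ge setT
  (@measurable_odd _ _ _ _ 0) mge measurableT.
have -> : P setT = 1%E by exact: probability_setT.
move=> /(_ _ D mD); rewrite setTI mul1e; apply => A B mA mB.
rewrite setTI mul1e setIC (indep_odd (k := 0) fK)//.
- by rewrite ge_law// muleC.
- exact: measurable_preimage.
move=> y y' Ky Ky' yy'; rewrite /preimage/= !geE//.
have [_ s] := KS Ky; have [X' s'] := KS Ky'.
by have [/(_ isT)[_ ->]] := nonanticipating Fbij X' s s' yy' (lexx 0) (lexx 0).
Qed.

Lemma joint_even D : measurable D ->
  P [set y : config | D ((y 0).1, go y)] = (mu \x nu)%E D.
Proof.
move=> mD.
have := @law_unique_prod _ _ _ _ _ _ _ P mu nu (fun y : config => (y 0).1) go setT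
  (@measurable_even _ _ _ _ 0) mgo measurableT.
have -> : P setT = 1%E by exact: probability_setT.
move=> /(_ _ D mD); rewrite setTI mul1e; apply => A B mA mB.
rewrite setTI mul1e setIC (indep_even (k := 0) fK)//.
- by rewrite go_law// muleC.
- exact: measurable_preimage.
move=> y y' Ky Ky' yy'; rewrite /preimage/= !goE//.
have [_ s] := KS Ky; have [X' s'] := KS Ky'.
by have [_ /(_ isT)[_ ->]] := nonanticipating Fbij X' s s' yy' (lexx (-1)) (lexx 0).
Qed.

Lemma T_preII_step y A : K y -> T_preII Fs A y <-> A (step (S y)).
Proof.
move=> Ky; have [Xy s] := KS Ky; split; last first.
  by move=> AS; split => //; exists (lxe (S y)), (lxo (S y)), (lue (S y)), (luo (S y)).
move=> [_ [xe [xo [ue [uo [s' +]]]]]].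
have := @XstarII_same _ _ _ _ Fs y (Lattice xe xo ue uo) (S y) Xy s' s.
move=> h; congr (A _); apply/funext => k; rewrite /step.
have [/= he _] := h (2 * k + 1) 1; have [/= _ ho] := h (2 * k + 2) 1.
by congr (_, _); [apply: (proj1 (he _))|apply: (proj1 (ho _))]; lia.
Qed.

(* The reversed time-one configuration has law P by invariance, and its carrier
   at 0 is that of y; so the independence of U_0 and x_1 under P turns into the
   independence of U_0 and x_0^1. *)
Lemma invariantII_law : T_invariantII Fs P ->
  forall D, measurable D -> (mu \x nu)%E (Fs @^-1` D) = (mut \x nut)%E D.
Proof.
move=> TP.
(* One inequality for all [D] is enough: both sides are probabilities, so the complement of [D]
   gives the other. *)
have le D : measurable D -> ((mut \x nut)%E D <= (mu \x nu)%E (Fs @^-1` D))%E.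
  move=> mD.
  pose B := [set y : config | D ((y 0).2, ge y)].
  have mB : measurable B.
    apply: (measurable_preimage _ mD); apply: measurable_fun_pair => //.
    exact: measurable_odd.
  have mFD := measurable_preimage mF mD.
  rewrite -(joint_odd mD) -(joint_even mFD).
  pose rev : config -> config := @reversal X0 Xt0.
  have mrev : measurable_fun setT rev by exact: measurable_reversal.
  have [mK _] := fK.
  (* Intersecting with [K] makes the reversed time-one configuration typical, so that uniqueness and
     [geE] apply to it. *)
  have mKB := measurableI _ _ mK mB.
  have mA := measurable_preimage mrev mKB.
  have -> : P [set y : config | D ((y 0).2, ge y)] = P (rev @^-1` (K `&` B)).
    rewrite (reversal_law lawP mKB); apply: (eq_full fK) => //.
    by move=> y Ky; split => // -[].
  have [M1 [_ [mM1 [_ [M1T [_ [_ <-]]]]]]] := TP _ mA.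
  apply: (le_full fK) => //.
    apply: (measurable_preimage (f := fun y : config => ((y 0).1, go y)) _ mFD).
    by apply: measurable_fun_pair => //; exact: measurable_even.
  move=> y Ky /M1T/(T_preII_step _ Ky)[Krev].
  have [X' s'] := KS Krev; have [Xy s] := KS Ky.
  rewrite /B /= geE// (lue_reversal_step s X' s') /rev /reversal /=.
  (* The odd entry of pair 0 after reversal is [lxo (S y) 0 1], since 2(-1) + 2 = 0; with U_0 it
     forms the output of [Fs] at site 0. *)
  have [s1 [_ s3]] := s; have := s1 0 0 isT; rewrite /= goE// -(proj1 (s3 0)).
  by move=> ->.
move=> D mD; apply/eqP; rewrite eq_le le// andbT.
have mFD := measurable_preimage mF mD.
have := le _ (measurableC mD).
rewrite preimage_setC [X in (X <= _)%E -> _](probability_setC (mut \x nut)%E mD).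
rewrite [X in (_ <= X)%E -> _](probability_setC (mu \x nu)%E mFD).
by rewrite leeD2lE// leeN2.
Qed.

(** * The converse: independence along the sites of the time-one configuration *)

Section converse.
Hypothesis F_law : forall D, measurable D ->
  (mu \x nu)%E (Fs @^-1` D) = (mut \x nut)%E D.
Variables (h g : Xt0 * Ut0 -> X0 * U0) (N : set (Xt0 * Ut0)).
Hypotheses (FK : cancel Fs h) (mg : measurable_fun setT g).
Hypotheses (fN : full (mut \x nut)%E N) (gE : forall w, N w -> g w = h w).

Lemma ae_inverse_law D : measurable D -> (mut \x nut)%E (g @^-1` D) = (mu \x nu)%E D.
Proof.
move=> mD; have mgD := measurable_preimage mg mD.
rewrite -F_law//.
have fFN := @full_preimage _ _ _ _ _ (mu \x nu)%E (mut \x nut)%E Fs N mF F_law fN.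
apply: (eq_full fFN) => //; first exact: measurable_preimage.
by move=> w Nw; rewrite /preimage/= gE// FK.
Qed.

(** The pairs entering sites 2k+1 and 2k. Since [ge] and [go] see only the carriers U_0 and U_{-1},
    the other carriers are read after a shift. *)
Let odd_in (k : int) (y : config) := ((y k).2, ge (shift k y)).
Let even_in (k : int) (y : config) := ((y k).1, go (shift k y)).

(** A measurable version of [step (S y)]. Pair [k] of the image consists of sites 2k+1 and 2k+2,
    hence the index k+1 in the second entry. *)
Definition ae_step (y : config) : config :=
  fun k => ((g (odd_in k y)).1, (Fs (even_in (k + 1) y)).1).

Let measurable_odd_in k : measurable_fun setT (odd_in k).
Proof.
apply: measurable_fun_pair; first exact: measurable_odd.
by apply: (measurableT_comp mge); exact: measurable_shift.
Qed.

Let measurable_even_in k : measurable_fun setT (even_in k).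
Proof.
apply: measurable_fun_pair; first exact: measurable_even.
by apply: (measurableT_comp mgo); exact: measurable_shift.
Qed.

Lemma measurable_ae_step : measurable_fun setT ae_step.
Proof.
apply: measurable_configP => k.
  exact: (measurableT_comp measurable_fst (measurableT_comp mg (measurable_odd_in k))).
exact: (measurableT_comp measurable_fst (measurableT_comp mF (measurable_even_in (k + 1)))).
Qed.

(** Only countably many shifts occur, so this set still has full measure; on it the whole time-one
    row is given by [ae_step]. *)
Let K' := [set y : config | forall k, K (shift k y) /\ N (odd_in k y)].

Let fK' : full P K'.
Proof.
pose L := K `&` [set y : config | N ((y 0).2, ge y)].
have fL : full P L.
  apply: fullI => //; have [mN PN] := fN; split; last by rewrite joint_odd.
  apply: (measurable_preimage (f := fun y : config => ((y 0).2, ge y)) _ mN).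
  by apply: measurable_fun_pair => //; exact: measurable_odd.
have -> : K' = [set y | forall k, ((shift k : config -> config) @^-1` L) y].
  by apply/seteqP; split => y H k; have := H k; rewrite /L /odd_in /= /shift add0r.
apply: full_countable => k.
apply: (@full_preimage _ _ _ _ _ P P (shift k : config -> config) L) => //.
  exact: measurable_shift.
exact: (shift_law lawP).
Qed.

Let shift0 (y : config) : shift 0 y = y.
Proof. by apply/funext => j; rewrite /shift addr0. Qed.

Let KK' y : K' y -> K y.
Proof. by move=> /(_ 0)[]; rewrite shift0. Qed.

Let geK k y : K' y -> ge (shift k y) = lue (S y) (2 * k) 0.
Proof.
move=> Ky; have [_ s] := KS (KK' Ky); have [/[dup] Kk /KS[X s'] _] := Ky k.
have [/(_ isT)[_ /=]] := XstarII_same X (solves_shift k s) s' 0 0.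
by rewrite add0r geE.
Qed.

Let goK k y : K' y -> go (shift k y) = luo (S y) (2 * k - 1) 0.
Proof.
move=> Ky; have [_ s] := KS (KK' Ky); have [/[dup] Kk /KS[X s'] _] := Ky k.
have [_ /(_ isT)[_ /=]] := XstarII_same X (solves_shift k s) s' (-1) 0.
by rewrite goE// addrC => <-.
Qed.

Let odd_out k y : K' y ->
  g (odd_in k y) = (lxe (S y) (2 * k + 1) 1, luo (S y) (2 * k + 1) 0).
Proof.
move=> Ky; have [_ [_ [s2 s3]]] := KS (KK' Ky); have [_ Nk] := Ky k.
rewrite gE// /odd_in geK// -(proj2 (s3 k)).
have := s2 (2 * k + 1) 0; rewrite addrK => ->; last by lia.
by rewrite FK.
Qed.

Let even_out k y : K' y ->
  Fs (even_in k y) = (lxo (S y) (2 * k) 1, lue (S y) (2 * k) 0).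
Proof.
move=> Ky; have [_ [s1 [_ s3]]] := KS (KK' Ky).
by rewrite /even_in goK// -(proj1 (s3 k)) s1; [|lia].
Qed.

Let ae_stepE y : K' y -> ae_step y = step (S y).
Proof.
move=> Ky; apply/funext => k; rewrite /ae_step odd_out// even_out// /step.
by congr (_, lxo _ _ _); lia.
Qed.

(** The bound M-1 reflects the shift contained in the dynamics: site n of the image is the lattice
    variable at n+1. *)
Let step_agree M y y' : K' y -> K' y' -> agree_upto M y y' ->
  (forall k, 2 * k <= M -> ge (shift k y) = ge (shift k y')) /\
  (forall k, 2 * k - 1 <= M -> go (shift k y) = go (shift k y')) /\
  agree_upto (M - 1) (ae_step y) (ae_step y').
Proof.
move=> Ky Ky' yy'; have [_ s] := KS (KK' Ky); have [X' s'] := KS (KK' Ky').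
have na := nonanticipating Fbij X' s s' yy'.
split; first by move=> k kM; rewrite !geK//; apply: (proj2 ((na _ 0 kM _).1 _)) => //; lia.
split; first by move=> k kM; rewrite !goK//; apply: (proj2 ((na _ 0 kM _).2 _)) => //; lia.
move=> k; rewrite !ae_stepE//; split => kM /=.
  by apply: (proj1 ((na _ 1 _ _).1 _)) => //; lia.
by apply: (proj1 ((na _ 1 _ _).2 _)) => //; lia.
Qed.

Let step_cyl a n A B := ae_step @^-1` cyl (window a n) A B.

Let measurable_step_cyl a n A B :
  (forall k, measurable (A k)) -> (forall k, measurable (B k)) ->
  measurable (step_cyl a n A B).
Proof.
move=> mA mB; apply: (measurable_preimage measurable_ae_step).
exact: measurable_cyl.
Qed.

Let step_cyl_agree a n A B y y' :
  agree_upto (2 * (a + n%:Z) - 1) (ae_step y) (ae_step y') ->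
  step_cyl a n A B y <-> step_cyl a n A B y'.
Proof.
move=> yy'; split => H k /[dup] /mapP[i]; rewrite mem_iota => ni kE /H;
  have [e1 e2] := yy' k; rewrite e1 ?e2//; lia.
Qed.

(** Induction on the length of the block, with the carrier leaving its last site 2(a+n) included.
    Each step treats site 2k+1 with the inverse and then site 2k+2 with [Fs], where k = a+n. *)
Lemma step_window_law a n A B C :
  (forall k, measurable (A k)) -> (forall k, measurable (B k)) -> measurable C ->
  P (step_cyl a n A B `&` (ge \o (shift (a + n%:Z) : config -> config)) @^-1` C) =
  ((\prod_(k <- window a n) (mu (A k) * mut (B k))) * nut C)%E.
Proof.
move=> mA mB; elim: n C => [|n IH] C mC.
  rewrite big_nil mul1e -ge_law//.
  rewrite -(shift_law lawP a (measurable_preimage mge mC)).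
  congr (P _); rewrite addr0; apply/seteqP; split => y; first by move=> [].
  by split.
pose k := a + n%:Z; pose E := step_cyl a n A B.
have mE : measurable E by exact: measurable_step_cyl.
have PE : P E = (\prod_(k <- window a n) (mu (A k) * mut (B k)))%E.
  by have := IH setT measurableT; rewrite preimage_setT setIT probability_setT mule1.
(* The event [E] and the carrier into site 2k+1 depend on sites up to 2k; hence, given [E], the pair
   entering site 2k+1 has law mut x nut. *)
have lawE D : measurable D -> P (E `&` odd_in k @^-1` D) = (P E * (mut \x nut)%E D)%E.
  apply: (@law_unique_prod _ _ _ _ _ _ _ P mut nut (fun y : config => (y k).2)
    (ge \o (shift k : config -> config))) => //.
  - exact: measurable_odd.
  - by apply: (measurableT_comp mge); exact: measurable_shift.
  move=> A1 B1 mA1 mB1; rewrite [X in _ `&` X]setIC setIA (indep_odd fK')//.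
  - by rewrite IH// PE -muleA [X in (_ * X)%E]muleC.
  - apply: measurableI => //; apply: (measurable_preimage _ mB1).
    by apply: (measurableT_comp mge); exact: measurable_shift.
  move=> y y' Ky Ky' yy'; have [eg [_ ea]] := step_agree Ky Ky' yy'.
  by rewrite /preimage /= eg// /setI/= /E (step_cyl_agree _ _ ea).
(* The inverse turns this law into mu x nu, so fixing the new value at site 2k+1 leaves the outgoing
   carrier independent with law nu. *)
pose E2 := E `&` (g \o odd_in k) @^-1` (A k `*` setT).
have mE2 : measurable E2.
  apply: measurableI => //; apply: (measurable_preimage (measurableT_comp mg _)) => //.
  exact: measurableX.
have E2_law C1 : measurable C1 ->
    P (E2 `&` (go \o (shift (k + 1) : config -> config)) @^-1` C1) =
    (P E * (mu (A k) * nu C1))%E.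
  move=> mC1; have mAC := measurableX (mA k) mC1.
  rewrite -(product_measure1E mu nu (mA k) mC1) -ae_inverse_law// -lawE; last first.
    exact: measurable_preimage.
  apply: (eq_full fK').
  - apply: measurableI => //; apply: (measurable_preimage _ mC1).
    by apply: (measurableT_comp mgo); exact: measurable_shift.
  - by apply: measurableI => //; apply: measurable_preimage => //; exact: measurable_preimage.
  move=> y Ky; rewrite /E2 /preimage /setI /= goK// odd_out//=.
  have -> : 2 * (k + 1) - 1 = 2 * k + 1 by lia.
  by split=> [[[? [? _]] ?]|[? [? ?]]].
have PE2 : P E2 = (P E * mu (A k))%E.
  by have := E2_law setT measurableT; rewrite preimage_setT setIT probability_setT mule1.
(* The same argument at site 2k+2: [E2] and its incoming carrier depend on sites up to 2k+1. *)
have lawE2 D : measurable D -> P (E2 `&` even_in (k + 1) @^-1` D) = (P E2 * (mu \x nu)%E D)%E.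
  apply: (@law_unique_prod _ _ _ _ _ _ _ P mu nu (fun y : config => (y (k + 1)).1)
    (go \o (shift (k + 1) : config -> config))) => //.
  - exact: measurable_even.
  - by apply: (measurableT_comp mgo); exact: measurable_shift.
  move=> A1 B1 mA1 mB1; rewrite [X in _ `&` X]setIC setIA (indep_even fK')//.
  - by rewrite E2_law// PE2 -!muleA [X in (_ * (_ * X))%E]muleC.
  - apply: measurableI => //; apply: (measurable_preimage _ mB1).
    by apply: (measurableT_comp mgo); exact: measurable_shift.
  move=> y y' Ky Ky' yy'; have [_ [og ea]] := step_agree Ky Ky' yy'.
  have ea' : agree_upto (2 * (a + n%:Z) - 1) (ae_step y) (ae_step y').
    by move=> j; split => jn; [apply: (proj1 (ea j))|apply: (proj2 (ea j))]; rewrite /k; lia.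
  have gk : (g (odd_in k y)).1 = (g (odd_in k y')).1.
    by apply: (proj1 (ea k)); lia.
  by rewrite /preimage /= og// /setI/= /E2 /E /setI/= (step_cyl_agree _ _ ea') gk.
have mBC := measurableX (mB k) mC.
transitivity (P E2 * (mut \x nut)%E (B k `*` C))%E; last first.
  rewrite PE2 PE /window /mkseq -addn1 iotaD map_cat big_cat/= big_seq1 add0n.
  by rewrite [X in (_ * X)%E](product_measure1E mut nut)// -!muleA.
rewrite -F_law// -lawE2; last exact: measurable_preimage.
apply: (eq_full fK').
- apply: measurableI; first exact: measurable_step_cyl.
  by apply: (measurable_preimage _ mC); apply: (measurableT_comp mge); exact: measurable_shift.
- by apply: measurableI => //; apply: measurable_preimage => //; exact: measurable_preimage.
move=> y Ky; rewrite /preimage /setI /= even_out//= geK// /E2 /E /setI /preimage/=.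
have -> : a + n.+1%:Z = k + 1 by rewrite /k; lia.
have yk : (Fs (even_in (k + 1) y)).1 = lxo (S y) (2 * (k + 1)) 1 by rewrite even_out.
rewrite /step_cyl /cyl /preimage/=; split.
  move=> [H Cy]; have [] := H k; first by apply/mapP; exists n; rewrite // mem_iota; lia.
  rewrite yk => Ak Bk; split; last by split.
  split => // j /mapP[i]; rewrite mem_iota => ni ->.
  by apply: H; apply/mapP; exists i => //; rewrite mem_iota; lia.
move=> [[H [Ak _]] [Bk Cy]]; split => // j /mapP[i]; rewrite mem_iota => ni ->.
have [<-|ni'] := eqVneq n i; first by rewrite -/k yk.
by apply: H; apply/mapP; exists i => //; rewrite mem_iota; lia.
Qed.

Lemma law_invariantII : T_invariantII Fs P.
Proof.
move=> A mA; apply: (full_cmeasure (K := K') (A := ae_step @^-1` A) fK').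
- exact: (measurable_preimage measurable_ae_step).
- apply: (configII_law_unique measurable_ae_step _ lawP mA).
  apply: iid_lawII_window => a n A1 B1 mA1 mB1.
  have := step_window_law a n mA1 mB1 measurableT.
  by rewrite preimage_setT setIT probability_setT mule1.
by move=> y Ky; rewrite (T_preII_step _ (KK' Ky)) /preimage/= ae_stepE.
Qed.

End converse.
End invariance.
End typeII.

Lemma invariantII_iff (R : realType) (dX dXt dU dUt : measure_display)
     (X0 : measurableType dX) (Xt0 : measurableType dXt)
     (U0 : measurableType dU) (Ut0 : measurableType dUt)
     (Fs : X0 * U0 -> Xt0 * Ut0)
     (mu : probability X0 R) (mut : probability Xt0 R)
     (nu : probability U0 R) (nut : probability Ut0 R)
     (P : probability (configII X0 Xt0) R) :
     polish R X0 -> polish R Xt0 -> polish R U0 -> polish R Ut0 ->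
     measurable_fun setT Fs -> bijective Fs ->
     iid_lawII mu mut P ->
     cmeasure_is P (XstarII Fs) 1%E ->
     (forall B : set U0, measurable B -> cmeasure_is P (Um1_preII Fs B) (nu B)) ->
     (forall B : set Ut0, measurable B -> cmeasure_is P (U0_preII Fs B) (nut B)) ->
     (T_invariantII Fs P <->
      (forall C : set (Xt0 * Ut0), measurable C ->
         (mu \x nu)%E (Fs @^-1` C) = (mut \x nut)%E C)).
Proof.
move=> pX pXt pU pUt mF Fbij lawP X1 nuE nutE.
have [S [K [go [ge [[fK KS] [mgo goE] [mge geE] go_law ge_law]]]]] :=
  carrier_version pU pUt X1 nuE nutE.
split; first exact: (invariantII_law mF Fbij lawP fK KS mgo mge goE geE go_law ge_law).
move=> F_law; have [h FK hK] := Fbij.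
have [g [N [mg [fN gE]]]] := ae_measurable_inverse (P := (mu \x nu)%E) (Q := (mut \x nut)%E)
  (polish_prod pX pU) (polish_prod pXt pUt) mF FK hK F_law.
exact: (law_invariantII mF Fbij lawP fK KS mgo mge goE geE ge_law F_law FK mg fN gE).
Qed.

(** * Type I *)

Lemma cmeasure_preimage (R : realType) d d' (T : measurableType d)
    (T' : measurableType d') (P : set T -> \bar R) (Q : set T' -> \bar R)
    (f : T -> T') (g : T' -> T) S r :
  cancel f g -> measurable_fun setT g ->
  (forall A, measurable A -> Q A = P (f @^-1` A)) ->
  cmeasure_is P S r -> cmeasure_is Q (g @^-1` S) r.
Proof.
move=> fgK mg QP [M1 [M2 [mM1 [mM2 [M1S [SM2 [M21 <-]]]]]]].
have m1 := measurable_preimage mg mM1; have m2 := measurable_preimage mg mM2.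
have E (A : set T) : f @^-1` (g @^-1` A) = A.
  by apply/seteqP; split => x; rewrite /preimage/= fgK.
exists (g @^-1` M1), (g @^-1` M2); split => //; split => //.
split; first by move=> x /M1S.
split; first by move=> x /SM2.
split; last by rewrite QP// E.
by rewrite QP; [rewrite -[RHS]M21; congr P; exact: (E (M2 `\` M1))|exact: measurableD].
Qed.

(** * Type I configurations read in pairs *)

Section encoding.
Context (d : measure_display) (X : measurableType d).

(** The offset [c] is the site that comes first in pair 0: the value 0 encodes configurations, and 1
    absorbs the extra shift of the type II dynamics. *)
Definition pairing (c : int) (x : configI X) : configII X X :=
  fun k => (x (2 * k + c), x (2 * k + 1 + c)).

Definition unpairing (c : int) (y : configII X X) : configI X :=
  fun n => if (2 %| n - c)%Z then (y ((n - c) %/ 2)%Z).1 else (y ((n - c) %/ 2)%Z).2.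

Lemma pairingK c : cancel (pairing c) (unpairing c).
Proof.
by move=> x; apply/funext => n; rewrite /unpairing; case: ifPn => nc; rewrite /pairing /=;
  congr x; lia.
Qed.

Lemma unpairingK c : cancel (unpairing c) (pairing c).
Proof.
move=> y; apply/funext => k; rewrite /unpairing /pairing.
rewrite ifT; last by lia.
rewrite ifF; last by lia.
have -> : ((2 * k + c - c) %/ 2)%Z = k by lia.
have -> : ((2 * k + 1 + c - c) %/ 2)%Z = k by lia.
by case: (y k).
Qed.

Lemma measurable_coord n : measurable_fun setT (fun x : configI X => x n).
Proof. by move=> _ A mA; rewrite setTI; apply: sub_sigma_algebra; exists n, A. Qed.

Lemma measurable_pairing c : measurable_fun setT (pairing c).
Proof. by apply: measurable_configP => k; exact: measurable_coord. Qed.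

Lemma measurable_unpairing c : measurable_fun setT (unpairing c).
Proof.
apply: (@measurability _ _ _ (configI X) setT _ (@cylI _ X)) => // _ [_ [n [A [mA ->]]] <-].
rewrite setTI /unpairing /preimage /=; case: (2 %| n - c)%Z.
  exact: (measurable_preimage (measurable_even _)).
exact: (measurable_preimage (measurable_odd _)).
Qed.

Context (R : realType) (mu : probability X R) (P : probability (configI X) R).
Hypothesis lawP : iid_lawI mu P.

Lemma pairing_iid c : iid_lawII mu mu (fun C => P (pairing c @^-1` C)).
Proof.
move=> s A B us mA mB.
pose s' := map (fun k => 2 * k + c) s ++ map (fun k => 2 * k + 1 + c) s.
pose D n := if (2 %| n - c)%Z then A ((n - c) %/ 2)%Z else B ((n - c) %/ 2)%Z.
have D0 k : D (2 * k + c) = A k.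
  by rewrite /D ifT; [congr A; lia|lia].
have D1 k : D (2 * k + 1 + c) = B k.
  by rewrite /D ifF; [congr B; lia|lia].
have us' : uniq s'.
  rewrite cat_uniq !map_inj_uniq ?us /=; try by move=> i j; lia.
  rewrite andbT; apply/hasPn => _ /mapP[i _ ->]; apply/negP => /mapP[j _]; lia.
have := @lawP s' D us'.
rewrite big_cat !big_map/=.
under eq_bigr do rewrite D0.
under [in X in (_ * X)%E]eq_bigr do rewrite D1.
rewrite -big_split/= => <-; last by move=> n; rewrite /D; case: ifP.
congr (P _); apply/seteqP; split => x H.
  by move=> n; rewrite mem_cat => /orP[] /mapP[k /H[Ak Bk] ->]; rewrite ?D0 ?D1.
move=> k ks; rewrite /pairing /= -D0 -D1; split; apply: H; rewrite mem_cat.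
  by apply/orP; left; apply/mapP; exists k.
by apply/orP; right; apply/mapP; exists k.
Qed.

End encoding.

(** * Type I lattices as type II lattices *)

Section lattice_typeI.
Context (d : measure_display) (X : measurableType d) (U : Type) (F : X * U -> X * U).

Lemma solvesI_shift c x xl ul : solvesI F x xl ul ->
  solvesI F (fun n => x (n + c)) (fun n => xl (n + c)) (fun n => ul (n + c)).
Proof.
move=> [s1 s2]; split=> [n t|n]; last exact: s2.
by have -> : n - 1 + c = n + c - 1 by lia.
Qed.

Lemma XstarI_shift c x : XstarI F x -> XstarI F (fun n => x (n + c)).
Proof.
move=> [xl [ul [s u]]]; exists (fun n => xl (n + c)), (fun n => ul (n + c)).
split=> [|xl' ul' /(solvesI_shift (- c)) s']; first exact: solvesI_shift.
have [<- <-] : (fun n => xl' (n - c)) = xl /\ (fun n => ul' (n - c)) = ul.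
  by apply: u; rewrite (_ : x = (fun n => x (n - c + c)))//; apply/funext => n; rewrite subrK.
by split; apply/funext => n; rewrite addrK.
Qed.

Lemma U_preI_shift B x : U_preI F (-1) B (fun n => x (n + 1)) <-> U_preI F 0 B x.
Proof.
have xE : x = (fun n => x (n - 1 + 1)) by apply/funext => n; rewrite subrK.
split=> [[/(@XstarI_shift (-1)) Xx [xl [ul [/(solvesI_shift (-1)) s Bu]]]]|[Xx [xl [ul [s Bu]]]]].
  rewrite -xE in Xx s; split => //.
  by exists (fun n => xl (n - 1)), (fun n => ul (n - 1)).
split; first exact: XstarI_shift.
by exists (fun n => xl (n + 1)), (fun n => ul (n + 1)); split => //; exact: solvesI_shift.
Qed.

Hypothesis FK : involutive F.

(** Keeps from each of the two type II families the entries of the parity at which it is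
    meaningful. *)
Definition merge (T : Type) (f g : int -> int -> T) (n t : int) :=
  if (2 %| n + t)%Z then f n t else g n t.

Lemma solvesI_merge y xe xo ue uo : solvesII F y xe xo ue uo ->
  solvesI F (unpairing 0 y) (merge xe xo) (merge ue uo).
Proof.
move=> [s1 [s2 s3]]; split=> [n t|n]; rewrite /merge; last first.
  rewrite /unpairing subr0; case: ifPn => n2.
    by rewrite -(proj1 (s3 _)); congr (xe _ _); lia.
  by rewrite -(proj2 (s3 _)); congr (xo _ _); lia.
case: ifPn => nt.
  by rewrite !ifF ?s1//; lia.
by rewrite !ifT ?s2 ?FK//; lia.
Qed.

(** One family serves both parities, because an involution is its own inverse. *)
Lemma solvesII_double y xl ul : solvesI F (unpairing 0 y) xl ul ->
  solvesII F y xl xl ul ul.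
Proof.
move=> [s1 s2]; split=> [n t _|]; first exact: s1.
split=> [n t _|k]; first by rewrite -s1 FK.
rewrite !s2 /unpairing !subr0 ifT; last by lia.
rewrite ifF; last by lia.
by split; [congr ((y _).1)|congr ((y _).2)]; lia.
Qed.

Lemma XstarII_I y : XstarII F y <-> XstarI F (unpairing 0 y).
Proof.
split=> [[xe [xo [ue [uo [s u]]]]]|[xl [ul [s u]]]].
  exists (merge xe xo), (merge ue uo); split; first exact: solvesI_merge.
  move=> xl ul /solvesII_double/u h; rewrite /merge.
  by split; apply/funext => n; apply/funext => t; have [he ho] := h n t;
    case: ifPn => [/he[]|/ho[]].
exists xl, xl, ul, ul; split; first exact: solvesII_double.
move=> xe xo ue uo /solvesI_merge/u[<- <-] n t; rewrite /merge.
by split => [->|/negbTE->].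
Qed.

Lemma Um1_preII_I B y : Um1_preII F B y <-> U_preI F (-1) B (unpairing 0 y).
Proof.
split=> [[/XstarII_I Xy [xe [xo [ue [uo [s Bu]]]]]]|[/XstarII_I Xy [xl [ul [s Bu]]]]].
  by split => //; exists (merge xe xo), (merge ue uo); split => //; exact: solvesI_merge.
by split => //; exists xl, xl, ul, ul; split => //; exact: solvesII_double.
Qed.

Lemma U0_preII_I B y : U0_preII F B y <-> U_preI F 0 B (unpairing 0 y).
Proof.
split=> [[/XstarII_I Xy [xe [xo [ue [uo [s Bu]]]]]]|[/XstarII_I Xy [xl [ul [s Bu]]]]].
  by split => //; exists (merge xe xo), (merge ue uo); split => //; exact: solvesI_merge.
by split => //; exists xl, xl, ul, ul; split => //; exact: solvesII_double.
Qed.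

(** The type II dynamics records sites 2k+1 and 2k+2 of the time-one row, which is [pairing 1] of
    the type I image. *)
Lemma T_preII_I A y :
  T_preII F A y <-> T_preI F (pairing 1 @^-1` A) (unpairing 0 y).
Proof.
have E (xl : int -> int -> X) : pairing 1 (fun n => xl n 1) =
    (fun k => (xl (2 * k + 1) 1, xl (2 * k + 2) 1)).
  by apply/funext => k; rewrite /pairing; congr (_, xl _ _); lia.
split=> [[/XstarII_I Xy [xe [xo [ue [uo [s Bu]]]]]]|[/XstarII_I Xy [xl [ul [s Bu]]]]].
  split => //; exists (merge xe xo), (merge ue uo); split; first exact: solvesI_merge.
  move: Bu; rewrite /preimage /= E; congr A; apply/funext => k; rewrite /merge.
  by congr (_, _); [rewrite ifT|rewrite ifF]; rewrite //; lia.
split => //; exists xl, xl, ul, ul; split; first exact: solvesII_double.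
by rewrite -E.
Qed.

End lattice_typeI.

(* With equal types and equal marginals the type II model is the type I model,
   up to the extra shift in T, which does not affect the invariance of an iid law. *)
Lemma invariantI_iff (R : realType) (dX dU : measure_display)
     (X0 : measurableType dX) (U0 : measurableType dU)
     (F : X0 * U0 -> X0 * U0)
     (mu : probability X0 R) (nu : probability U0 R)
     (P : probability (configI X0) R) :
     polish R X0 -> polish R U0 ->
     measurable_fun setT F -> involutive F ->
     iid_lawI mu P ->
     cmeasure_is P (XstarI F) 1%E ->
     (forall B : set U0, measurable B -> cmeasure_is P (U_preI F (-1) B) (nu B)) ->
     (T_invariantI F P <->
      (forall C : set (X0 * U0), measurable C ->
         (mu \x nu)%E (F @^-1` C) = (mu \x nu)%E C)).
Proof.
move=> pX pU mF FK lawP X1 nuE.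
have mp c := @measurable_pairing _ X0 c; have mu_ c := @measurable_unpairing _ X0 c.
pose enc : {mfun configI X0 >-> configII X0 X0} :=
  HB.pack (pairing 0) (isMeasurableFun.Build _ _ _ _ _ (mp 0)).
pose Q : probability (configII X0 X0) R := distribution P enc.
have lawQ : iid_lawII mu mu Q := pairing_iid lawP 0.
have PQ c C : measurable C -> P (pairing c @^-1` C) = Q C.
  by move=> mC; exact: (configII_law_unique (mp c) (pairing_iid lawP c) lawQ mC).
have toQ S r : cmeasure_is P S r -> cmeasure_is Q (unpairing 0 @^-1` S) r.
  by apply: (cmeasure_preimage (@pairingK _ X0 0)).
have toP S r : cmeasure_is Q S r -> cmeasure_is P (pairing 0 @^-1` S) r.
  apply: (cmeasure_preimage (@unpairingK _ X0 0)) => // A mA.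
  rewrite -(PQ 0); last exact: (measurable_preimage (mu_ 0)).
  by congr (P _); apply/seteqP; split => x; rewrite /preimage/= pairingK.
(* The type II statement also asks for the law of U_0. It is again nu: U_0 is U_{-1} of the
   configuration moved by one site, and [P] is invariant under this move. *)
have nu0E B : measurable B -> cmeasure_is P (U_preI F 0 B) (nu B).
  move=> mB.
  (* The moves by one site in either direction, written through the encodings so that measurability
     and invariance follow from [PQ] with offsets 0 and 1. *)
  pose next := unpairing 0 \o pairing 1 : configI X0 -> configI X0.
  pose prev := unpairing 1 \o pairing 0 : configI X0 -> configI X0.
  have nextE x : next x = (fun n => x (n + 1)).
    have -> : next x = unpairing 0 (pairing 0 (fun n => x (n + 1))).
      by congr unpairing; apply/funext => k; rewrite /pairing !addr0.
    by rewrite pairingK.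
  have -> : U_preI F 0 B = next @^-1` U_preI F (-1) B.
    by apply/seteqP; split => x; rewrite /preimage/= nextE;
      case: (U_preI_shift F B x).
  apply: (@cmeasure_preimage _ _ _ _ _ P P prev next) (nuE B mB).
  - by move=> x; rewrite /next /prev /= unpairingK pairingK.
  - exact: (measurableT_comp (mu_ 0) (mp 1)).
  move=> A mA; have mA' := measurable_preimage (mu_ 1) mA.
  have -> : prev @^-1` A = pairing 0 @^-1` (unpairing 1 @^-1` A) by [].
  rewrite PQ// -(PQ 1)//; congr (P _).
  by apply/seteqP; split => x; rewrite /preimage/= pairingK.
have TE A : T_preII F A = unpairing 0 @^-1` T_preI F (pairing 1 @^-1` A).
  by apply/seteqP; split => y; rewrite /preimage/= T_preII_I.
have <- : T_invariantII F Q <-> T_invariantI F P.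
  split=> TQ A mA.
    have mA' := measurable_preimage (mu_ 1) mA.
    have := toP _ _ (TQ _ mA'); rewrite TE -(PQ 1)//.
    have -> : pairing 1 @^-1` (unpairing 1 @^-1` A) = A.
      by apply/seteqP; split => x; rewrite /preimage/= pairingK.
    congr cmeasure_is.
    by apply/seteqP; split => x; rewrite /preimage/= pairingK.
  by rewrite TE -(PQ 1)//; apply: toQ; apply: TQ; exact: measurable_preimage.
apply: invariantII_iff => //.
- by exists F.
- have -> : XstarII F = unpairing 0 @^-1` XstarI F.
    by apply/seteqP; split => y; rewrite /preimage/= XstarII_I.
  exact: toQ.
- move=> B mB.
  have -> : Um1_preII F B = unpairing 0 @^-1` U_preI F (-1) B.
    by apply/seteqP; split => y; rewrite /preimage/= Um1_preII_I.
  exact/toQ/nuE.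
- move=> B mB.
  have -> : U0_preII F B = unpairing 0 @^-1` U_preI F 0 B.
    by apply/seteqP; split => y; rewrite /preimage/= U0_preII_I.
  exact/toQ/nu0E.
Qed.

Theorem theorem2p1 :
  (* (a) type I model *)
  (forall (R : realType) (dX dU : measure_display)
     (X0 : measurableType dX) (U0 : measurableType dU)
     (F : X0 * U0 -> X0 * U0)
     (mu : probability X0 R) (nu : probability U0 R)
     (P : probability (configI X0) R),
     polish R X0 -> polish R U0 ->
     measurable_fun setT F -> involutive F ->
     iid_lawI mu P ->
     cmeasure_is P (XstarI F) 1%E ->
     (forall B : set U0, measurable B -> cmeasure_is P (U_preI F (-1) B) (nu B)) ->
     (T_invariantI F P <->
      (forall C : set (X0 * U0), measurable C ->
         (mu \x nu)%E (F @^-1` C) = (mu \x nu)%E C))) /\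
  (* (b) type II model *)
  (forall (R : realType) (dX dXt dU dUt : measure_display)
     (X0 : measurableType dX) (Xt0 : measurableType dXt)
     (U0 : measurableType dU) (Ut0 : measurableType dUt)
     (Fs : X0 * U0 -> Xt0 * Ut0)
     (mu : probability X0 R) (mut : probability Xt0 R)
     (nu : probability U0 R) (nut : probability Ut0 R)
     (P : probability (configII X0 Xt0) R),
     polish R X0 -> polish R Xt0 -> polish R U0 -> polish R Ut0 ->
     measurable_fun setT Fs -> bijective Fs ->
     iid_lawII mu mut P ->
     cmeasure_is P (XstarII Fs) 1%E ->
     (forall B : set U0, measurable B -> cmeasure_is P (Um1_preII Fs B) (nu B)) ->
     (forall B : set Ut0, measurable B -> cmeasure_is P (U0_preII Fs B) (nut B)) ->
     (T_invariantII Fs P <->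
      (forall C : set (Xt0 * Ut0), measurable C ->
         (mu \x nu)%E (Fs @^-1` C) = (mut \x nut)%E C))).
Proof.
split=> [R dX dU X0 U0 F mu nu P pX pU mF FK lawP X1 nuE|].
  exact: invariantI_iff.
move=> R dX dXt dU dUt X0 Xt0 U0 Ut0 Fs mu mut nu nut P pX pXt pU pUt mF Fbij lawP X1 nuE nutE.
exact: invariantII_iff.
Qed.
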